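(* A Loday infinity algebra is a $\mathbb{Z}^n$-graded vector space $V$ together with a sequence of structure maps $$\pi=(\pi_1,\pi_2,\ldots)=\sum_p\pi_p\in C^Q(V)=\prod_{p\ge1}M^{(Q+(1-p)e_1,p-1)}(V)$$ of odd degree $Q$, such that $$\sum_{s+t=p}(-1)^{1+(s-1)\langle e_1,Q\rangle}[\pi_s,\pi_t]^\otimes=0,\quad\forall p\ge2.$$ That is, for every $\mathbb{Z}^n$-graded vector space $V$ and every $Q\in\mathbb{Z}^n$ with $\langle Q,Q\rangle$ odd, the bijection $\phi$ from $C^Q(V)$ to weight $Q$ coderivations of $(T(\downarrow V),\Delta)$ identifies the sequences satisfying these conditions with the weight $Q$ codifferentials of $(T(\downarrow V),\Delta)$.
   Context: A strongly homotopy Loday (Loday infinity) algebra is by definition a $\mathbb{Z}^n$-graded vector space $V$ endowed with a codifferential of odd weight of the tensor coalgebra $(T(\downarrow V),\Delta)$. Vector spaces are over a field $\mathbb{K}$ of characteristic $0$; for $\alpha,\beta\in\mathbb{Z}^m$, $\langle\alpha,\beta\rangle=\sum_i\alpha_i\beta_i$. A homogeneous vector or map and its degree/weight are denoted by the same symbol; $Q\in\mathbb{Z}^n$ is odd if $\langle Q,Q\rangle$ is odd; $e_1=(1,0,\ldots,0)\in\mathbb{Z}^n$. $M^{(A,a)}(V)$, $a\ge0$, is the space of $(a+1)$-linear maps $V^{\times(a+1)}\to V$ of weight $A\in\mathbb{Z}^n$. Indices $s,t$ are $\ge1$. Tensor coalgebra. For a graded space $W$, $T(W)=\bigoplus_{p\ge1}W^{\otimes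 p}$, $\mathbb{Z}^n$-graded by total degree, with coproduct $\Delta(w_1\otimes\ldots\otimes w_p)=\sum_{I\cup J=N^{(p-1)},\,I\ne\emptyset}\varepsilon_W(I;J)W_I\bigotimes W_J\otimes w_p$. Here $N^{(p)}=(1,\ldots,p)$, $I,J$ are disjoint naturally ordered subsets with the given union, $W_I=w_{i_1}\otimes\ldots\otimes w_{i_{|I|}}$, and $\varepsilon_W(I;J)$ is the Koszul sign of the rearrangement of $(W_I,W_J)$ into increasing index order. Tensor products of maps: $(f\otimes g)(v_1\otimes v_2)=(-1)^{\langle g,v_1\rangle}f(v_1)\otimes g(v_2)$. A weight $Q$ coderivation is a weight $Q$ linear map with $\Delta Q=(Q\otimes\mathrm{id}+\mathrm{id}\otimes Q)\Delta$; a codifferential is a coderivation with $Q^2=0$. The graded commutator is $[Q,Q']=QQ'-(-1)^{\langle Q,Q'\rangle}Q'Q$. A weight $Q$ coderivation is uniquely determined by its corestrictions $Q_p:W^{\otimes p}\hookrightarrow T(W)\xrightarrow{Q}T(W)\to W$, which can be arbitrary weight $Q$ maps, via $$Q(w_1\otimes\ldots\otimes w_p)=\sum_{I\cup J\cup K=N^{(p)},\;I,J<K}\varepsilon_W(I;J)(-1)^{\langle Q,W_I\rangle}W_I\otimes Q_{|J|+1}(W_J\otimes w_{k_1})\otimes W_{K\setminus k_1},$$ with $I,J$ possibly empty, $K=(k_1<k_2<\ldots)$ nonempty, and $I<K$ meaning that the last element of $I$ is smaller than $k_1$. Desuspension. $\downarrow V$ is $V$ with grading $(\downarrow V)^\alpha=V^{\alpha+e_1}$;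 $\downarrow:V\to\downarrow V$ has weight $-e_1$ and inverse $\uparrow$; $\uparrow^{\otimes p}=\uparrow\otimes\ldots\otimes\uparrow$ with the sign convention $(f\otimes g)(v_1\otimes v_2)=(-1)^{\langle g,v_1\rangle}f(v_1)\otimes g(v_2)$ for tensor products of maps. The bijection $\phi$ sends $\pi\in C^Q(V)$ to the weight $Q$ coderivation of $T(\downarrow V)$ with corestrictions $Q_p=(-1)^{\frac{p(p-1)}{2}}\downarrow\circ\pi_p\circ\uparrow^{\otimes p}$, $p\ge1$. For $A\in M^{(A,a)}(V)$, $\phi_{(A,a)}(A)$ denotes the weight $A+ae_1$ coderivation whose only (possibly) nonzero corestriction is $(-1)^{\frac{a(a+1)}{2}}\downarrow\circ A\circ\uparrow^{\otimes(a+1)}$. The stem bracket of $A\in M^{(A,a)}(V)$, $B\in M^{(B,b)}(V)$ is $[A,B]^\otimes:=(-1)^{1+\langle ae_1,be_1+B\rangle}\phi^{-1}_{(A+B,a+b)}([\phi_{(A,a)}(A),\phi_{(B,b)}(B)])\in M^{(A+B,a+b)}(V)$. *)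

(* Defs.v *)
(* Mathematical Components, with the classical layer of MathComp-Analysis and
   free modules {freeg T / K} from multinomials. *)
From HB Require Import structures.
From mathcomp Require Import all_boot all_order all_algebra.
From mathcomp Require Import boolp classical_sets functions.
From mathcomp Require Import ring_quotient.
From mathcomp.multinomials Require Import freeg.

Set Implicit Arguments.
Unset Strict Implicit.
Unset Printing Implicit Defensive.

Import GRing.Theory.
Local Open Scope ring_scope.
Local Open Scope quotient_scope.
Local Open Scope classical_set_scope.

(** ** Modules given by generators and relations *)

Inductive lspan (K : fieldType) (M : lmodType K) (S : set M) : M -> Prop :=
| lspan0 : lspan S 0
| lspanD a u v : S u -> lspan S v -> lspan S (a *: u + v).

Section Presented.
Variables (K : fieldType) (T : choiceType) (rel : set {freeg T / K}).

Lemma lspanP (M : lmodType K) (S : set M) k u v :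
  lspan S u -> lspan S v -> lspan S (k *: u + v).
Proof.
move=> Su Sv; elim: Su => [|a x y Sx _ IH]; first by rewrite scaler0 add0r.
by rewrite scalerDr scalerA -addrA; apply: lspanD.
Qed.

Definition relpred : pred {freeg T / K} := fun x => `[< lspan rel x >].

Fact relpred_zmod : zmod_closed relpred.
Proof.
split=> [|x y]; first by apply/asboolP; apply: lspan0.
move=> /asboolP hx /asboolP hy; apply/asboolP.
by rewrite addrC -scaleN1r; apply: lspanP.
Qed.

HB.instance Definition _ := GRing.isZmodClosed.Build _ relpred relpred_zmod.

Definition relspan : zmodClosed {freeg T / K} :=
  GRing.ZmodClosed.clone _ relpred _.

Definition presented := Quotient.quot relspan.
HB.instance Definition _ := GRing.Zmodule.on presented.

Definition pres_cls (r : {freeg T / K}) : presented := \pi_(Quotient.quot relspan) r.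
Definition pres_repr (x : presented) : {freeg T / K} := repr (x : (Quotient.quot relspan)).
Definition gen (t : T) : presented := pres_cls << t >>.

Lemma pres_clsP r r' : reflect (lspan rel (r - r')) (pres_cls r == pres_cls r').
Proof.
rewrite /pres_cls -(Quotient.idealrBE relspan).
exact: asboolP.
Qed.

Lemma pres_reprK x : pres_cls (pres_repr x) = x.
Proof. exact: reprK. Qed.

Lemma pres_cls0 : pres_cls 0 = 0.
Proof. exact: raddf0. Qed.

Lemma pres_clsD r r' : pres_cls (r + r') = pres_cls r + pres_cls r'.
Proof. exact: raddfD. Qed.

Lemma pres_reprE r : lspan rel (pres_repr (pres_cls r) - r).
Proof. by apply/pres_clsP; rewrite pres_reprK. Qed.

Definition pres_scale (k : K) (x : presented) : presented :=
  pres_cls (k *: pres_repr x).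

Lemma pres_scaleE k r : pres_scale k (pres_cls r) = pres_cls (k *: r).
Proof.
apply/eqP/pres_clsP; rewrite -scalerBr -[_ *: _]addr0.
by apply: lspanP; [exact: pres_reprE | exact: lspan0].
Qed.

Fact pres_scaleA a b x : pres_scale a (pres_scale b x) = pres_scale (a * b) x.
Proof. by rewrite -(pres_reprK x) !pres_scaleE scalerA. Qed.
Fact pres_scale1 : left_id 1 pres_scale.
Proof. by move=> x; rewrite -(pres_reprK x) pres_scaleE scale1r. Qed.
Fact pres_scaleDr : right_distributive pres_scale +%R.
Proof.
move=> a x y; rewrite -(pres_reprK x) -(pres_reprK y) -pres_clsD.
by rewrite !pres_scaleE scalerDr pres_clsD.
Qed.
Fact pres_scaleDl x : {morph pres_scale^~ x : a b / a + b}.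
Proof.
by move=> a b; rewrite -(pres_reprK x) !pres_scaleE scalerDl pres_clsD.
Qed.

HB.instance Definition _ := GRing.Zmodule_isLmodule.Build K presented
  pres_scaleA pres_scale1 pres_scaleDr pres_scaleDl.

Lemma pres_clsZ k r : pres_cls (k *: r) = k *: pres_cls r.
Proof. by rewrite -pres_scaleE. Qed.

Lemma pres_clsB r r' : pres_cls (r - r') = pres_cls r - pres_cls r'.
Proof. exact: raddfB. Qed.

Lemma pres_cls_rel r : rel r -> pres_cls r = 0.
Proof.
move=> hr; rewrite -(raddf0 \pi_(Quotient.quot relspan)); apply/eqP/pres_clsP.
by rewrite subr0 -[r]scale1r -[_ *: _]addr0; apply: lspanD => //; apply: lspan0.
Qed.

Lemma linear_comb3 (U V : lmodType K) (f : U -> V) k a b c :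
  linear f -> f (a - k *: b - c) = f a - k *: f b - f c.
Proof.
move=> fl; have fB x y : f (x - y) = f x - f y.
  by rewrite addrC -scaleN1r fl scaleN1r addrC.
by rewrite !fB -[k *: b]addr0 fl -(subrr b) fB subrr addr0.
Qed.

Lemma fglift_linear (U : lmodType K) (f : T -> U) : linear (fglift f).
Proof.
have fB : {morph fglift f : x y / x - y} := lift_is_additive f.
pose fA : {additive {freeg T / K} -> U} :=
  HB.pack (fglift f) (GRing.isZmodMorphism.Build _ _ (fglift f) fB).
move=> k x y; rewrite -[fglift f]/(fA : _ -> _) raddfD; congr (_ + _).
rewrite -{1}(freeg_sumE x) scaler_sumr -[in RHS](freeg_sumE x).
rewrite !raddf_sum; apply: eq_bigr => t _ /=.
have -> : k *: << coeff t x *g t >> = << k * coeff t x *g t >> :> {freeg T / K}.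
  by apply/eqP/freeg_eqP => z; rewrite coeffZ !coeffU mulrA.
by rewrite !liftU scalerA.
Qed.

Lemma presented_lift (U : lmodType K) (f : T -> U) :
  (forall r, rel r -> fglift f r = 0) ->
  exists L : presented -> U, linear L /\ forall t, L (gen t) = f t.
Proof.
move=> frel; have fl := fglift_linear f.
have fspan r : lspan rel r -> fglift f r = 0.
  elim=> [|a u v /frel fu _ fv]; last by rewrite fl fu fv scaler0 addr0.
  by have := fl (-1) 0 0; rewrite scaler0 addr0 scaleN1r addNr.
have frepr r : fglift f (pres_repr (pres_cls r)) = fglift f r.
  apply/eqP; rewrite -subr_eq0 addrC -scaleN1r -fl scaleN1r addrC.
  by rewrite fspan //; apply: pres_reprE.
exists (fun x => fglift f (pres_repr x)); split; last first.
  by move=> t; rewrite frepr liftU scale1r.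
move=> k x y; rewrite -(pres_reprK x) -(pres_reprK y) -pres_clsZ -pres_clsD.
by rewrite !frepr fl.
Qed.

End Presented.

(** ** Tensor products and tensor powers *)

Section Tensor.
Variable K : fieldType.

Definition tens2_rel (U V : lmodType K) : set {freeg (U * V)%type / K} :=
  [set r | (exists k u u' v,
     r = << (k *: u + u', v) >> - k *: << (u, v) >> - << (u', v) >>) \/
           (exists u k v v',
     r = << (u, k *: v + v') >> - k *: << (u, v) >> - << (u, v') >>)].

Definition tensor (U V : lmodType K) : lmodType K := presented (@tens2_rel U V).

Definition tens2 (U V : lmodType K) (u : U) (v : V) : tensor U V :=
  gen (@tens2_rel U V) (u, v).

(* Words of all lengths are presented at once; killing the empty word leaves
   T(W), the direct sum of the W^{(x) p} with p >= 1. *)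
Definition tens_rel (W : lmodType K) : set {freeg (seq W) / K} :=
  [set r | r = << [::] >> \/
     exists s t k u v, r = << s ++ (k *: u + v) :: t >>
                         - k *: << s ++ u :: t >> - << s ++ v :: t >>].

Definition tensalg (W : lmodType K) : lmodType K := presented (@tens_rel W).

Definition tens (W : lmodType K) (s : seq W) : tensalg W :=
  gen (@tens_rel W) s.

Lemma tens2_linl (U V : lmodType K) (v : V) : linear (fun u : U => tens2 u v).
Proof.
move=> k u u'; apply/eqP; rewrite -subr_eq0 opprD addrA; apply/eqP.
rewrite /tens2 /gen -pres_clsZ -!pres_clsB; apply: pres_cls_rel.
by left; exists k, u, u', v.
Qed.

Lemma tens2_linr (U V : lmodType K) (u : U) : linear (fun v : V => tens2 u v).
Proof.
move=> k v v'; apply/eqP; rewrite -subr_eq0 opprD addrA; apply/eqP.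
rewrite /tens2 /gen -pres_clsZ -!pres_clsB; apply: pres_cls_rel.
by right; exists u, k, v, v'.
Qed.

Lemma tens_nil (W : lmodType K) : tens [::] = 0 :> tensalg W.
Proof. by apply: pres_cls_rel; left. Qed.

Lemma tens_lin (W : lmodType K) (s t : seq W) :
  linear (fun w => tens (s ++ w :: t)).
Proof.
move=> k v v'; apply/eqP; rewrite -subr_eq0 opprD addrA; apply/eqP.
rewrite /tens /gen -pres_clsZ -!pres_clsB; apply: pres_cls_rel.
by right; exists s, t, k, v, v'.
Qed.

Lemma tens2_lift (U V X : lmodType K) (F : U -> V -> X) :
  (forall v, linear (F^~ v)) -> (forall u, linear (F u)) ->
  exists L : tensor U V -> X, linear L /\ forall u v, L (tens2 u v) = F u v.
Proof.
move=> Fl Fr; have [|L [Llin LE]] :=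
  @presented_lift K _ (@tens2_rel U V) X (fun uv => F uv.1 uv.2).
  move=> r; have fl := fglift_linear (fun uv => F uv.1 uv.2).
  case=> [[k [u [u' [v ->]]]]|[u [k [v [v' ->]]]]].
    rewrite linear_comb3 // !liftU /= !scale1r Fl.
    by rewrite addrAC addrK subrr.
  rewrite linear_comb3 // !liftU /= !scale1r Fr.
  by rewrite addrAC addrK subrr.
by exists L; split=> // u v; rewrite LE.
Qed.

Lemma tens_lift (W X : lmodType K) (F : seq W -> X) :
  F [::] = 0 -> (forall s t, linear (fun w => F (s ++ w :: t))) ->
  exists L : tensalg W -> X, linear L /\ forall s, L (tens s) = F s.
Proof.
move=> F0 Fl; apply: (@presented_lift K _ (@tens_rel W) X F) => r.
have fl := fglift_linear F.
case=> [->|[s [t [k [u [v ->]]]]]]; first by rewrite liftU F0 scaler0.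
rewrite linear_comb3 // !liftU /= !scale1r Fl.
by rewrite addrAC addrK subrr.
Qed.

Lemma tensalg_ind (W : lmodType K) (P : tensalg W -> Prop) :
  P 0 -> (forall k s u, P u -> P (k *: tens s + u)) -> forall u, P u.
Proof.
move=> P0 PS u; rewrite -(pres_reprK u) -(freeg_sumE (pres_repr u)).
elim: (dom _) => [|t d IH]; first by rewrite big_nil pres_cls0.
rewrite big_cons pres_clsD.
have -> : << coeff t (pres_repr u) *g t >> = coeff t (pres_repr u) *: << t >>
    :> {freeg (seq W) / K}.
  by apply/eqP/freeg_eqP => z; rewrite coeffZ !coeffU mul1r.
by rewrite pres_clsZ; apply: PS.
Qed.

End Tensor.

(** ** Z^n-graded vector spaces, n >= 1 *)

Definition zdeg (n : nat) := 'rV[int]_n.+1.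

Definition ip n (a b : zdeg n) : int := \sum_i a 0 i * b 0 i.

Definition e1 n : zdeg n := delta_mx 0 0.

Definition ksign (K : fieldType) (z : int) : K := (-1) ^ z.

(* A word of homogeneous vectors is encoded as a sequence of pairs (degree,
   vector), the vector belonging to the component of that degree. *)
Notation degs x := (unzip1 x).
Notation vecs x := (unzip2 x).
Notation tdeg x := (\sum_(c <- x) c.1).
Notation tvec x := (\sum_(c <- x) c.2).

Definition homog n (V : eqType) (comp : zdeg n -> set V) (x : seq (zdeg n * V)) :=
  forall c, c \in x -> comp c.1 c.2.

Record grading (n : nat) (K : fieldType) (V : lmodType K) := Grading {
  comp :> zdeg n -> set V;
  comp0 : forall a, comp a 0;
  comp_lin : forall a k u v, comp a u -> comp a v -> comp a (k *: u + v);
  comp_span : forall v, exists2 x, homog comp x & v = tvec x;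
  comp_direct : forall x, homog comp x -> uniq (degs x) -> tvec x = 0 ->
                forall c, c \in x -> c.2 = 0
}.

Section Graded.
Variables (n : nat) (K : fieldType).
Implicit Types (V W : lmodType K) (a : zdeg n).

Section Desuspension.
Variables (V : lmodType K) (gV : grading n V).

Definition desusp_comp a : set V := gV (a + e1 n).

Fact desusp_comp0 a : desusp_comp a 0.
Proof. exact: comp0. Qed.

Fact desusp_comp_lin a k u v :
  desusp_comp a u -> desusp_comp a v -> desusp_comp a (k *: u + v).
Proof. exact: comp_lin. Qed.

Fact desusp_comp_span v : exists2 x, homog desusp_comp x & v = tvec x.
Proof.
have [x hx ->] := comp_span gV v.
exists [seq (c.1 - e1 n, c.2) | c <- x]; last by rewrite big_map.
by move=> c /mapP [d /hx ? ->]; rewrite /desusp_comp /= subrK.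
Qed.

Fact desusp_comp_direct x :
  homog desusp_comp x -> uniq (degs x) -> tvec x = 0 ->
  forall c, c \in x -> c.2 = 0.
Proof.
move=> hx ux x0 c cx; pose y := [seq (c.1 + e1 n, c.2) | c <- x].
apply: (@comp_direct _ _ _ gV y _ _ _ (c.1 + e1 n, c.2)).
- by move=> d /mapP [d' /hx ? ->].
- have -> : degs y = [seq a + e1 n | a <- degs x] by rewrite /unzip1 -!map_comp.
  by rewrite (map_inj_uniq (addIr _)).
- by rewrite big_map.
- exact: (map_f (fun c => (c.1 + e1 n, c.2)) cx).
Qed.

(* The desuspension of V has the same underlying vector space, so that the
   desuspension map and its inverse are the identity, of weights - e1 and e1. *)
Definition desusp : grading n V :=
  Grading desusp_comp0 desusp_comp_lin desusp_comp_span desusp_comp_direct.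

End Desuspension.

(* T(W)^a *)
Definition tcomp W (gW : grading n W) a : set (tensalg W) :=
  lspan [set t | exists x, [/\ homog gW x, tdeg x = a & t = tens (vecs x)]].

(** Linear maps specified on tensors of homogeneous vectors.  The specifications
    used below are multilinear, hence determine a unique linear map; see
    [linextP], [coprodP], [tmapP] and [tproj1P]. *)
Definition linext W (gW : grading n W) (U : lmodType K)
    (F : seq (zdeg n * W) -> U) : tensalg W -> U :=
  xget (fun=> 0) [set L | linear L /\
                     forall x, homog gW x -> L (tens (vecs x)) = F x].

Definition hmultilinear W (gW : grading n W) (U : lmodType K)
    (F : seq (zdeg n * W) -> U) :=
  F [::] = 0 /\
  forall x y a k u v, homog gW x -> homog gW y -> gW a u -> gW a v ->
    F (x ++ (a, k *: u + v) :: y) = k *: F (x ++ (a, u) :: y) + F (x ++ (a, v) :: y).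

Section Extension.
Variables (W : lmodType K) (gW : grading n W) (U : lmodType K).

Definition hlinear (H : zdeg n * W -> U) := forall a k u v, gW a u -> gW a v ->
  H (a, k *: u + v) = k *: H (a, u) + H (a, v).

Lemma hlinear0 H a : hlinear H -> H (a, 0) = 0.
Proof.
move=> Hl; have := Hl a (-1) 0 0 (comp0 gW a) (comp0 gW a).
by rewrite scaler0 addr0 scaleN1r addNr.
Qed.

Lemma homog_cons c x : homog gW (c :: x) <-> gW c.1 c.2 /\ homog gW x.
Proof.
split=> [h|[hc hx] d]; last by rewrite inE => /orP [/eqP ->|/hx].
by split=> [|d dx]; apply: h; rewrite inE ?eqxx ?dx ?orbT.
Qed.

Lemma homog_cat x y : homog gW (x ++ y) <-> homog gW x /\ homog gW y.
Proof.
split=> [h|[hx hy] d]; last by rewrite mem_cat => /orP [/hx|/hy].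
by split=> d dx; apply: h; rewrite mem_cat dx ?orbT.
Qed.

Lemma comp_sum (I : Type) (r : seq I) (P : pred I) (f : I -> W) a :
  (forall i, P i -> gW a (f i)) -> gW a (\sum_(i <- r | P i) f i).
Proof.
move=> h; elim/big_ind: _ => //; first exact: comp0.
by move=> u v gu gv; rewrite -[u]scale1r; apply: comp_lin.
Qed.

Lemma hlinear_sum (I : eqType) (r : seq I) H a (f : I -> W) :
  hlinear H -> (forall i, i \in r -> gW a (f i)) ->
  H (a, \sum_(i <- r) f i) = \sum_(i <- r) H (a, f i).
Proof.
move=> Hl h; have : gW a (\sum_(i <- r) f i) /\
    H (a, \sum_(i <- r) f i) = \sum_(i <- r) H (a, f i); last by case.
elim: r h => [|i r IH] h.
  by rewrite !big_nil; split; [apply: comp0 | apply: hlinear0].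
have [|gr IH'] := IH; first by move=> j jr; apply: h; rewrite inE jr orbT.
have gi : gW a (f i) by apply: h; rewrite inE eqxx.
have := Hl a 1 _ _ gi gr; have := @comp_lin _ _ _ gW a 1 _ _ gi gr.
by rewrite !big_cons !scale1r IH'.
Qed.

Lemma hlinear_tvec0 H x :
  hlinear H -> homog gW x -> tvec x = 0 -> \sum_(c <- x) H c = 0.
Proof.
move=> Hl hx x0; pose ds := undup (degs x).
have split_deg (X : zmodType) (f : zdeg n * W -> X) :
    \sum_(c <- x) f c = \sum_(a <- ds) \sum_(c <- [seq c <- x | c.1 == a]) f c.
  under [RHS]eq_bigr do rewrite big_filter.
  rewrite (exchange_big_dep xpredT) //= !big_seq; apply: eq_bigr => c cx.
  rewrite -big_filter (eq_filter (a2 := pred1 c.1)); last by move=> a /=; rewrite eq_sym.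
  by rewrite filter_pred1_uniq ?big_seq1 ?undup_uniq // mem_undup; apply: map_f.
pose s a := \sum_(c <- [seq c <- x | c.1 == a]) c.2.
have hg a c : c \in [seq c <- x | c.1 == a] -> gW a c.2.
  by rewrite mem_filter => /andP [/eqP <-]; apply: hx.
have gs a : gW a (s a).
  by rewrite /s big_seq; apply: comp_sum => c /hg.
have s0 a : a \in ds -> s a = 0.
  move=> ads.
  apply: (@comp_direct _ _ _ gW [seq (a, s a) | a <- ds] _ _ _ (a, s a)).
  - by move=> c /mapP [b _ ->]; apply: gs.
  - by rewrite /unzip1 -map_comp map_id undup_uniq.
  - by rewrite big_map -split_deg.
  - exact: map_f.
rewrite split_deg big_seq big1 // => a ads.
rewrite -[RHS](hlinear0 a Hl) -(s0 a ads) /s (hlinear_sum Hl); last exact: hg.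
by apply: eq_big_seq => c; rewrite mem_filter => /andP [/eqP <- _]; case: c.
Qed.

Definition hdec (v : W) : seq (zdeg n * W) :=
  projT1 (cid2 (comp_span gW v)).

Lemma hdec_homog v : homog gW (hdec v).
Proof. by rewrite /hdec; case: cid2. Qed.

Lemma hdec_sum v : tvec (hdec v) = v.
Proof. by rewrite /hdec; case: cid2. Qed.

Lemma hlinear_dec H x : hlinear H -> homog gW x ->
  \sum_(c <- hdec (tvec x)) H c = \sum_(c <- x) H c.
Proof.
move=> Hl hx; apply/eqP; rewrite -subr_eq0; apply/eqP.
pose y := hdec (tvec x) ++ [seq (c.1, - c.2) | c <- x].
have gN a u : gW a u -> gW a (- u).
  by move=> gu; rewrite -scaleN1r -[_ *: _]addr0; apply: comp_lin => //; apply: comp0.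
have hy : homog gW y.
  apply/homog_cat; split; first exact: hdec_homog.
  by move=> c /mapP [d /hx gd ->]; apply: gN.
transitivity (\sum_(c <- y) H c); last first.
  apply: hlinear_tvec0 => //.
  by rewrite big_cat big_map /= hdec_sum sumrN subrr.
rewrite big_cat big_map /=; congr (_ + _); rewrite -sumrN.
apply: eq_big_seq => c cx.
have := Hl c.1 (-1) c.2 0 (hx c cx) (comp0 gW _).
by rewrite (hlinear0 _ Hl) !addr0 !scaleN1r -surjective_pairing => ->.
Qed.

Fixpoint hext (F : seq (zdeg n * W) -> U) (s : seq W) : U :=
  if s is v :: s' then \sum_(c <- hdec v) hext (fun x => F (c :: x)) s' else F [::].

Lemma hextD k F1 F2 F s :
  (forall x, homog gW x -> F x = k *: F1 x + F2 x) ->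
  hext F s = k *: hext F1 s + hext F2 s.
Proof.
elim: s F F1 F2 => [|v s IH] F F1 F2 h /=; first exact: h.
rewrite scaler_sumr -big_split /=; apply: eq_big_seq => c /hdec_homog gc.
by apply: IH => x hx; apply: h; apply/homog_cons.
Qed.

Lemma hext_homog F x :
  (forall x y a k u v, homog gW x -> homog gW y -> gW a u -> gW a v ->
    F (x ++ (a, k *: u + v) :: y) =
      k *: F (x ++ (a, u) :: y) + F (x ++ (a, v) :: y)) ->
  homog gW x -> hext F (vecs x) = F x.
Proof.
elim: x F => [|c x IH] F Fl //= /homog_cons [gc hx].
have -> : c.2 = tvec [:: c] by rewrite big_seq1.
rewrite hlinear_dec; first last.
- by move=> d; rewrite inE => /eqP ->.
- move=> a k u v gu gv; apply: hextD => y hy.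
  exact: (Fl [::]).
rewrite big_seq1 IH // => y z a k u v hy hz gu gv.
by apply: (Fl (c :: y)) => //; apply/homog_cons.
Qed.

Lemma hext_lin F s t :
  (forall x y a k u v, homog gW x -> homog gW y -> gW a u -> gW a v ->
    F (x ++ (a, k *: u + v) :: y) =
      k *: F (x ++ (a, u) :: y) + F (x ++ (a, v) :: y)) ->
  linear (fun w => hext F (s ++ w :: t)).
Proof.
elim: s F => [|c s IH] F Fl k u v /=; last first.
  rewrite scaler_sumr -big_split /=; apply: eq_big_seq => d /hdec_homog gd.
  apply: IH => x y a k' u' v' hx hy gu gv.
  by apply: (Fl (d :: x)) => //; apply/homog_cons.
set H := fun c => hext (fun x => F (c :: x)) t.
have Hl : hlinear H.
  by move=> a k' u' v' gu gv; apply: hextD => x hx; apply: (Fl [::]).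
pose z := [seq (c.1, k *: c.2) | c <- hdec u] ++ hdec v.
have gZ a w : gW a w -> gW a (k *: w).
  by move=> gw; rewrite -[_ *: _]addr0; apply: comp_lin => //; apply: comp0.
have hz : homog gW z.
  apply/homog_cat; split; last exact: hdec_homog.
  by move=> c /mapP [d /hdec_homog gd ->]; apply: gZ.
have -> : k *: u + v = tvec z.
  by rewrite big_cat big_map /= -scaler_sumr !hdec_sum.
rewrite hlinear_dec // big_cat big_map /= scaler_sumr; congr (_ + _).
apply: eq_big_seq => c /hdec_homog gc; have := Hl c.1 k c.2 0 gc (comp0 gW _).
by rewrite (hlinear0 _ Hl) !addr0 -surjective_pairing.
Qed.

Lemma linextP (F : seq (zdeg n * W) -> U) : hmultilinear gW F ->
  linear (linext gW F) /\
  forall x, homog gW x -> linext gW F (tens (vecs x)) = F x.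
Proof.
case=> F0 Fl; rewrite /linext; set P := [set L | _].
suff : exists L, P L by move=> /(xgetPex (fun=> 0)).
have [|s t|L [Llin LE]] := @tens_lift K W U (hext F).
- exact: F0.
- exact: hext_lin.
by exists L; split=> // x hx; rewrite LE hext_homog.
Qed.

End Extension.

(* (-1)^kexp m d is the Koszul sign eps(I;J) for letters of degrees d, where the
   mask m encodes I = {i | m_i} and J is its complement: one factor for each
   inversion j < i with j in J and i in I. *)
Definition kexp (m : seq bool) (d : seq (zdeg n)) : int :=
  \sum_(i < size m) \sum_(j < i | nth false m i && ~~ nth false m j)
    ip (nth 0 d i) (nth 0 d j).

(* For x = w_1 ... w_p, m ranges over the subsets I of {1, ..., p-1};
   [mask m] ignores the last letter, and the second mask selects the letters of
   J followed by w_p. *)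
Definition coprod W (gW : grading n W) :
    tensalg W -> tensor (tensalg W) (tensalg W) :=
  linext gW (fun x =>
    \sum_(m : (size x).-1.-tuple bool | has id m)
      ksign K (kexp m (degs x)) *:
        tens2 (tens (mask m (vecs x)))
              (tens (mask (rcons (map negb m) true) (vecs x)))).

(* f (x) g for maps f and g of T(W), where g has weight B. *)
Definition tmap W (gW : grading n W) (f g : tensalg W -> tensalg W) (B : zdeg n) :
    tensor (tensalg W) (tensalg W) -> tensor (tensalg W) (tensalg W) :=
  xget (fun=> 0) [set L | linear L /\
    forall a x y, tcomp gW a x ->
      L (tens2 x y) = ksign K (ip B a) *: tens2 (f x) (g y)].

Definition tproj1 W : tensalg W -> W :=
  xget (fun=> 0) [set L | linear L /\
    forall s, L (tens s) = if s is [:: w] then w else 0].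

Definition coderivation W (gW : grading n W) (Q : zdeg n)
    (D : tensalg W -> tensalg W) : Prop :=
  [/\ linear D,
      forall a x, tcomp gW a x -> tcomp gW (a + Q) (D x) &
      forall x, coprod gW (D x) =
                tmap gW D id 0 (coprod gW x) + tmap gW id D Q (coprod gW x)].

Definition codifferential W (gW : grading n W) (Q : zdeg n)
    (D : tensalg W -> tensalg W) : Prop :=
  coderivation gW Q D /\ forall x, D (D x) = 0.

Definition gcomm W (Q Q' : zdeg n) (D D' : tensalg W -> tensalg W) :
    tensalg W -> tensalg W :=
  fun x => D (D' x) - ksign K (ip Q Q') *: D' (D x).

Section Specifications.
Variables (W : lmodType K) (gW : grading n W).

Lemma mask_at (T : Type) (b : seq bool) (s t : seq T) (u : T) :
  (size s <= size b)%N ->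
  mask b (s ++ u :: t) =
    mask (take (size s) b) s ++
    (if nth false b (size s) then [:: u] else [::]) ++ mask (drop (size s).+1 b) t.
Proof.
elim: s b => [|w s IH] [|c b] //= h; first by case: c; rewrite drop0.
by rewrite IH //; case: c.
Qed.

Lemma coprodP :
  linear (coprod gW) /\
  forall x, homog gW x -> coprod gW (tens (vecs x)) =
    \sum_(m : (size x).-1.-tuple bool | has id m)
      ksign K (kexp m (degs x)) *:
        tens2 (tens (mask m (vecs x)))
              (tens (mask (rcons (map negb m) true) (vecs x))).
Proof.
apply: linextP; split.
  by rewrite big_pred0 // => m; rewrite tuple0.
pose G N (d : seq (zdeg n)) (s : seq W) :
    tensor (tensalg W) (tensalg W) :=
  \sum_(m : N.-tuple bool | has id m)
      ksign K (kexp m d) *: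
        tens2 (tens (mask m s)) (tens (mask (rcons (map negb m) true) s)).
move=> x y a k u v _ _ _ _.
have GE w : (size (x ++ (a, w) :: y)).-1 = (size x + size y)%N /\
    [/\ degs (x ++ (a, w) :: y) = degs x ++ a :: degs y &
        vecs (x ++ (a, w) :: y) = vecs x ++ w :: vecs y].
  by rewrite size_cat /= addnS /unzip1 /unzip2 !map_cat.
have GG w : G (size (x ++ (a, w) :: y)).-1 (degs (x ++ (a, w) :: y))
              (vecs (x ++ (a, w) :: y)) =
            G (size x + size y)%N (degs x ++ a :: degs y) (vecs x ++ w :: vecs y).
  by have [-> [-> ->]] := GE w.
have := GG (k *: u + v); have := GG u; have := GG v.
rewrite {1 3 5}/G => -> -> ->; rewrite /G scaler_sumr -big_split /=.
apply: eq_bigr => m _.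
rewrite scalerA [k * _]mulrC -scalerA -scalerDr; congr (_ *: _).
have sx : size (vecs x) = size x by rewrite size_map.
have sm : (size (vecs x) <= size m)%N by rewrite sx size_tuple leq_addr.
have sJ : (size (vecs x) <= size (rcons (map negb m) true))%N.
  by rewrite size_rcons size_map leqW.
rewrite !(mask_at _ _ sm) !(mask_at _ _ sJ).
have -> : nth false (rcons (map negb m) true) (size (vecs x)) =
          ~~ nth false m (size (vecs x)).
  rewrite nth_rcons size_map; move: sm; rewrite leq_eqVlt => /orP [/eqP e|lt].
    by rewrite e ltnn eqxx nth_default.
  by rewrite lt (nth_map false).
case: nth; rewrite ?cat0s ?cat1s /=.
  by rewrite tens_lin tens2_linl.
by rewrite tens_lin tens2_linr.
Qed.

Lemma tproj1P : linear (@tproj1 W) /\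
  forall s : seq W, tproj1 (tens s) = if s is [:: w] then w else 0.
Proof.
rewrite /tproj1; set P := [set L | _].
suff : exists L, P L by move=> /(xgetPex (fun=> 0)).
apply: tens_lift => // s t k u v.
by case: s => [|? [|? ?]]; case: t => [|? ?]; rewrite //= scaler0 addr0.
Qed.

Lemma tmapP (f g : tensalg W -> tensalg W) B : linear f -> linear g ->
  linear (tmap gW f g B) /\
  forall a x y, tcomp gW a x ->
    tmap gW f g B (tens2 x y) = ksign K (ip B a) *: tens2 (f x) (g y).
Proof.
move=> fl gl; rewrite /tmap; set P := [set L | _].
suff : exists L, P L by move=> /(xgetPex (fun=> 0)).
have [|sl sE] := @linextP W gW (tensalg W)
  (fun x => ksign K (ip B (tdeg x)) *: tens (vecs x)).
  split=> [|x y a k u v _ _ _ _]; first by rewrite tens_nil scaler0.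
  rewrite /unzip2 !map_cat /= tens_lin !big_cat !big_cons /=.
  by rewrite scalerDr !scalerA [k * _]mulrC.
set sg := linext _ _ in sl sE.
have sgE a x : tcomp gW a x -> sg x = ksign K (ip B a) *: x.
  elim=> [|k _ v [y [hy <- ->]] _ IH].
    by have := sl (-1) 0 0; rewrite !scaler0 addr0 scaleN1r addNr.
  by rewrite sl sE // IH scalerDr !scalerA mulrC.
have [||L [Llin LE]] := @tens2_lift K (tensalg W)
  (tensalg W) (tensor (tensalg W) (tensalg W))
  (fun x y => tens2 (f (sg x)) (g y)).
- by move=> y k u v; rewrite sl fl tens2_linl.
- by move=> x k u v; rewrite gl tens2_linr.
exists L; split=> // a x y hx; rewrite LE (sgE a) //.
have f0 : f 0 = 0 by have := fl (-1) 0 0; rewrite scaler0 addr0 scaleN1r addNr.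
have := fl (ksign K (ip B a)) x 0; rewrite f0 !addr0 => ->.
have := tens2_linl (g y) (ksign K (ip B a)) (f x) 0.
have t0 : tens2 (0 : tensalg W) (g y) = 0.
  have := tens2_linl (g y) (-1) (0 : tensalg W) 0.
  by rewrite scaler0 addr0 scaleN1r addNr.
by rewrite t0 !addr0.
Qed.

End Specifications.

(** ** Cochains and the stem bracket *)

(* M^(A,a)(V): an (a+1)-linear map is encoded as a function on words which
   vanishes on the words of length different from a + 1. *)
Definition mmaps V (gV : grading n V) (A : zdeg n) (a : nat) : set (seq V -> V) :=
  [set f | [/\ forall s, size s != a.+1 -> f s = 0,
               forall s t, linear (fun v => f (s ++ v :: t)) &
               forall x, homog gV x -> size x = a.+1 ->
                         gV (tdeg x + A) (f (vecs x))]].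

(* C^Q(V): the sequences (pi_1, pi_2, ...), with the dummy entry pi_0 = 0. *)
Definition cochains V (gV : grading n V) (Q : zdeg n) : set (nat -> seq V -> V) :=
  [set pi | pi 0%N = 0 /\
     forall p, (0 < p)%N -> mmaps gV (Q + (1 - p%:Z) *: e1 n) p.-1 (pi p)].

(* Exponent of the sign by which up (x) ... (x) up acts on a word of vectors
   of degrees d in the desuspension:
   up^p (w_1 ... w_p) = (-1)^(<(p-1) e1, w_1>) up w_1 (x) up^(p-1) (w_2 ... w_p). *)
Fixpoint upexp (d : seq (zdeg n)) : int :=
  if d is a :: d' then ip ((size d')%:Z *: e1 n) a + upexp d' else 0.

Definition phi V (gV : grading n V) (Q : zdeg n) (pi : nat -> seq V -> V) :
    tensalg V -> tensalg V :=
  xget (fun=> 0) [set D | coderivation (desusp gV) Q D /\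
    forall p x, (0 < p)%N -> size x = p -> homog (desusp gV) x ->
      tproj1 (D (tens (vecs x))) =
      ksign K ((p * p.-1)./2)%:Z *: (ksign K (upexp (degs x)) *: pi p (vecs x))].

(* The sequence supported in arity p = a + 1, for which p (p - 1) / 2 is
   a (a + 1) / 2. *)
Definition phi1 V (gV : grading n V) (A : zdeg n) (a : nat) (f : seq V -> V) :
    tensalg V -> tensalg V :=
  phi gV (A + a%:Z *: e1 n) (fun p => if p == a.+1 then f else 0).

Definition phi1_inv V (gV : grading n V) (A : zdeg n) (a : nat)
    (D : tensalg V -> tensalg V) : seq V -> V :=
  xget 0 [set f | mmaps gV A a f /\ phi1 gV A a f = D].

Definition stem V (gV : grading n V) (A : zdeg n) (a : nat) (f : seq V -> V)
    (B : zdeg n) (b : nat) (g : seq V -> V) : seq V -> V :=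
  ksign K (1 + ip (a%:Z *: e1 n) (b%:Z *: e1 n + B)) *:
  phi1_inv gV (A + B) (a + b)
    (gcomm (A + a%:Z *: e1 n) (B + b%:Z *: e1 n)
       (phi1 gV A a f) (phi1 gV B b g)).

Definition loday_condition V (gV : grading n V) (Q : zdeg n)
    (pi : nat -> seq V -> V) : Prop :=
  forall p, (2 <= p)%N ->
    \sum_(1 <= s < p)
      ksign K (1 + (s%:Z - 1) * ip (e1 n) Q) *:
      stem gV (Q + (1 - s%:Z) *: e1 n) s.-1 (pi s)
              (Q + (1 - (p - s)%:Z) *: e1 n) (p - s).-1 (pi (p - s)%N) = 0.

End Graded.

(* Main.v *)
Require Import Defs.
From mathcomp Require Import all_boot all_order all_algebra.
From mathcomp Require Import boolp classical_sets functions.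
From mathcomp Require Import ring.

Set Implicit Arguments.
Unset Strict Implicit.
Unset Printing Implicit Defensive.

Import GRing.Theory.
Local Open Scope ring_scope.
Local Open Scope classical_set_scope.

(** Write a word as u c, with last letter c.  The coproduct is
      Delta (u c) = sum +- u' (x) u'' c
    over the unshuffles (u', u'') of u with u' nonempty.  The term with u' = u
    gives back u c, so a tensor is determined by its coproduct and its
    projection to W ([coprod_inj]).  As the other factors are shorter than u c,
    induction on the length shows that a coderivation is determined by its
    corestrictions ([coder_unique]).

    Conversely, given corestrictions q, the explicit formula for Q amounts to
      Q (u c) = Q (u) c + sum +- u' q (u'' c).
    By induction along this recursion, Q is a coderivation for the complete
    unshuffle coproduct u |-> sum +- u' (x) u'', which is coassociative and
    cocommutative ([codersum_unsh]); the rule for Delta follows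
    ([coder_exists]).  These identities hold between signed sums of values of
    an arbitrary function of words of homogeneous letters; multilinearity is
    needed only to descend to T(W).

    For V, a map of arity p and weight Q + (1 - p) e1 is the same as a map of
    weight Q for the degrees of the desuspension ([mmaps_desusp]), so cochains
    are exactly the families of corestrictions of weight Q, up to an invertible
    sign: phi is a bijection ([phi_bij]).

    Let D = phi pi and let D_s be the coderivation given by pi_s alone.  The
    graded commutator of two coderivations is a coderivation ([gcomm_coder]) and
    [D, D] = 2 D^2 since Q is odd; so in characteristic different from 2, D^2
    vanishes as soon as its corestrictions do.  As D_t maps words of length r
    to words of length r + 1 - t, the corestriction of D^2 to p - 1 letters is
    the sum over s + t = p of those of D_s D_t ([square_proj]).  On the other
    hand, the sign in the condition cancels the one in the stem bracket, so
    that the p-th condition says that the sum of the corestrictions of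
    [D_s, D_t] = D_s D_t + D_t D_s over s + t = p is zero ([stem_part]); this
    sum is twice the corestriction of D^2 to p - 1 letters. *)

(** * Signs and linear maps *)

Section Signs.
Variables (n : nat) (K : fieldType).
Implicit Types (a b c : zdeg n) (z : int).

Lemma ipC a b : ip a b = ip b a.
Proof. by apply: eq_bigr => i _; rewrite mulrC. Qed.

Lemma ipDl a b c : ip (a + b) c = ip a c + ip b c.
Proof. by rewrite -big_split; apply: eq_bigr => i _; rewrite mxE mulrDl. Qed.

Lemma ipDr a b c : ip a (b + c) = ip a b + ip a c.
Proof. by rewrite ipC ipDl !(ipC a). Qed.

Lemma ip0r a : ip a 0 = 0.
Proof. by apply: big1 => i _; rewrite mxE mulr0. Qed.

Lemma ipZl z a b : ip (z *: a) b = z * ip a b.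
Proof. by rewrite mulr_sumr; apply: eq_bigr => i _; rewrite mxE mulrA. Qed.

Lemma ksign0 : ksign K 0 = 1.
Proof. by []. Qed.

Lemma ksignD z z' : ksign K (z + z') = ksign K z * ksign K z'.
Proof. by rewrite /ksign expfzDr // oppr_eq0 oner_eq0. Qed.

Lemma ksign_sqr z : ksign K z * ksign K z = 1.
Proof. by rewrite /ksign -exprzMl ?unitrN1 // mulrNN mulr1 exp1rz. Qed.

(** Signs only depend on exponents modulo 2; the multiple of 2 is given as a sum,
    so that the hypothesis is a ring identity. *)
Lemma ksign_congr z z' y : z = z' + (y + y) -> ksign K z = ksign K z'.
Proof. by move=> ->; rewrite !ksignD ksign_sqr mulr1. Qed.

Lemma ksignK (U : lmodType K) z : involutive (GRing.scale (ksign K z) : U -> U).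
Proof. by move=> u; rewrite scalerA ksign_sqr scale1r. Qed.

Lemma ksign_scale_eq0 (U : lmodType K) z (u : U) : ksign K z *: u = 0 -> u = 0.
Proof. by move=> /(congr1 (fun v => ksign K z *: v)); rewrite ksignK scaler0. Qed.

Lemma ksign_odd z : odd `|z|%N -> ksign K z = -1.
Proof.
move=> oz; rewrite /ksign.
case: z oz => m /= om; first by rewrite -exprnP -signr_odd om expr1.
by rewrite NegzE -exprnN -signr_odd /= om expr1 invrN1.
Qed.

End Signs.

Section LinearRelations.
Variable K : fieldType.

(** Induction over the signed sums below transports such relations from the
    summands to the sums: equality, the graph of a linear map and membership of a
    subspace are the three that occur. *)
Definition lin_rel (U U' : lmodType K) (R : U -> U' -> Prop) :=
  R 0 0 /\
  forall k u v u' v', R u u' -> R v v' -> R (k *: u + v) (k *: u' + v').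

Lemma lin_relD (U U' : lmodType K) (R : U -> U' -> Prop) u v u' v' :
  lin_rel R -> R u u' -> R v v' -> R (u + v) (u' + v').
Proof. by case=> _ h; have := h 1 u v u' v'; rewrite !scale1r. Qed.

Lemma lin_relZ (U U' : lmodType K) (R : U -> U' -> Prop) k u u' :
  lin_rel R -> R u u' -> R (k *: u) (k *: u').
Proof. by case=> h0 h hu; have := h k u 0 u' 0 hu h0; rewrite !addr0. Qed.

Lemma lin_rel_eq (U : lmodType K) : lin_rel (fun u u' : U => u = u').
Proof. by split=> // k u v u' v' -> ->. Qed.

Lemma lin0 (U U' : lmodType K) (L : U -> U') : linear L -> L 0 = 0.
Proof. by move=> Ll; have := Ll (-1) 0 0; rewrite scaler0 addr0 scaleN1r addNr. Qed.

Lemma linD (U U' : lmodType K) (L : U -> U') u v : linear L -> L (u + v) = L u + L v.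
Proof. by move=> Ll; have := Ll 1 u v; rewrite !scale1r. Qed.

Lemma linZ (U U' : lmodType K) (L : U -> U') k u : linear L -> L (k *: u) = k *: L u.
Proof. by move=> Ll; have := Ll k u 0; rewrite (lin0 Ll) !addr0. Qed.

Lemma linBZ (U U' : lmodType K) (L : U -> U') k u v :
  linear L -> L (u - k *: v) = L u - k *: L v.
Proof. by move=> Ll; rewrite -!scaleNr [u + _]addrC Ll addrC. Qed.

Lemma lin_add (U U' : lmodType K) (f g : U -> U') :
  linear f -> linear g -> linear (fun t => f t + g t).
Proof. by move=> fl gl k u v; rewrite fl gl scalerDr addrACA. Qed.

Lemma lin_scale (U U' : lmodType K) a (f : U -> U') :
  linear f -> linear (fun t => a *: f t).
Proof. by move=> fl k u v; rewrite fl scalerDr !scalerA mulrC. Qed.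

Lemma lin_comp (U U' U'' : lmodType K) (f : U' -> U'') (g : U -> U') :
  linear f -> linear g -> linear (fun t => f (g t)).
Proof. by move=> fl gl k u v; rewrite gl fl. Qed.

Lemma lin_rel_map (U U' : lmodType K) (L : U -> U') :
  linear L -> lin_rel (fun u u' => L u = u').
Proof. by move=> Ll; split=> [|k u v _ _ <- <-]; [apply: lin0 | apply: Ll]. Qed.

End LinearRelations.

(** * Signed sums over unshuffles *)

Section Unshuffles.
Variables (n : nat) (K : fieldType) (W : lmodType K).
Notation word := (seq (zdeg n * W)).
Implicit Types (x y z I J : word) (c : zdeg n * W).

(** The sum of eps(I; J) F x_I x_J over the decompositions of x into two
    subwords.  When the first letter c goes to the second word, it has to cross
    the whole of the first one, whence the sign.  As the value type of F is
    arbitrary, nested sums express iterated coproducts. *)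
Fixpoint unsh (U : lmodType K) x (F : word -> word -> U) : U :=
  if x is c :: x' then
    unsh x' (fun I J => F (c :: I) J) +
    unsh x' (fun I J => ksign K (ip c.1 (tdeg I)) *: F I (c :: J))
  else F [::] [::].

Lemma unsh_rel (U U' : lmodType K) (R : U -> U' -> Prop) x F G :
  lin_rel R ->
  (forall I J, {subset I <= x} -> {subset J <= x} ->
     (size I + size J)%N = size x -> tdeg I + tdeg J = tdeg x ->
     R (F I J) (G I J)) ->
  R (unsh x F) (unsh x G).
Proof.
move=> hR; elim: x F G => [|c x IH] F G h /=; first by apply: h; rewrite ?big_nil ?addr0.
have subC I d : {subset I <= x} -> d \in I -> d \in c :: x.
  by move=> s dI; rewrite inE s ?orbT.
have subCC I : {subset I <= x} -> {subset c :: I <= c :: x}.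
  by move=> s d; rewrite !inE => /orP [->//|/s ->]; rewrite orbT.
apply: lin_relD => //; apply: IH => I J sI sJ sz dg; last first.
  apply: lin_relZ => //; apply: h.
  - by move=> d; apply: subC.
  - exact: subCC.
  - by rewrite /= addnS sz.
  - by rewrite !big_cons addrCA dg.
apply: h.
- exact: subCC.
- by move=> d; apply: subC.
- by rewrite /= addSn sz.
- by rewrite !big_cons -addrA dg.
Qed.

Lemma unsh_eq (U : lmodType K) x (F G : word -> word -> U) :
  (forall I J, {subset I <= x} -> {subset J <= x} ->
     (size I + size J)%N = size x -> tdeg I + tdeg J = tdeg x ->
     F I J = G I J) ->
  unsh x F = unsh x G.
Proof. by apply: unsh_rel; apply: lin_rel_eq. Qed.

Lemma unsh_map (U U' : lmodType K) (L : U -> U') x F : linear L ->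
  L (unsh x F) = unsh x (fun I J => L (F I J)).
Proof. by move=> Ll; apply: (unsh_rel (lin_rel_map Ll)). Qed.

Lemma unshZ (U : lmodType K) k x (F : word -> word -> U) :
  k *: unsh x F = unsh x (fun I J => k *: F I J).
Proof.
by apply: unsh_map => a u v; rewrite scalerDr !scalerA mulrC.
Qed.

Lemma unshD (U : lmodType K) x (F G : word -> word -> U) :
  unsh x F + unsh x G = unsh x (fun I J => F I J + G I J).
Proof.
elim: x F G => //= c x IH F G; rewrite addrACA; congr (_ + _); rewrite IH //.
by apply: unsh_eq => I J _ _ _ _; rewrite scalerDr.
Qed.

Lemma unsh_sum (U : lmodType K) (T : Type) (r : seq T) x (F : T -> word -> word -> U) :
  \sum_(t <- r) unsh x (F t) = unsh x (fun I J => \sum_(t <- r) F t I J).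
Proof.
elim: r => [|t r IH].
  (* 0 is written 0 *: 0 for the scalar to be factored out *)
  rewrite big_nil (@unsh_eq _ _ _ (fun _ _ => 0 *: 0)).
    by rewrite -unshZ scale0r.
  by move=> I J _ _ _ _; rewrite big_nil scaler0.
rewrite big_cons IH unshD; apply: unsh_eq => I J _ _ _ _; by rewrite big_cons.
Qed.

(** A last letter that goes to the first word has to cross the second one. *)
Lemma unsh_rcons (U : lmodType K) x c (F : word -> word -> U) :
  unsh (rcons x c) F =
  unsh x (fun I J => ksign K (ip c.1 (tdeg J)) *: F (rcons I c) J) +
  unsh x (fun I J => F I (rcons J c)).
Proof.
elim: x F => [|d x IH] F /=; first by rewrite !big_nil !ip0r !ksign0 !scale1r.
rewrite !IH [LHS]addrACA; congr (_ + _ + (_ + _)).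
apply: unsh_eq => I J _ _ _ _; rewrite !scalerA -!ksignD; congr (_ *: _).
apply: (@ksign_congr _ _ _ 0).
by rewrite -cats1 big_cat !big_cons big_nil /= !ipDr ip0r (ipC d.1 c.1); ring.
Qed.

(** Graded cocommutativity of the unshuffle coproduct. *)
Lemma unsh_sym (U : lmodType K) x (F : word -> word -> U) :
  unsh x F = unsh x (fun I J => ksign K (ip (tdeg I) (tdeg J)) *: F J I).
Proof.
elim: x F => [|c x IH] F /=; first by rewrite !big_nil ip0r ksign0 scale1r.
rewrite addrC; congr (_ + _); rewrite IH; apply: unsh_eq => I J _ _ _ _.
  rewrite scalerA -ksignD; congr (_ *: _); apply: (@ksign_congr _ _ _ 0).
  by rewrite big_cons ipDl; ring.
rewrite scalerA -ksignD; congr (_ *: _).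
apply: (@ksign_congr _ _ _ (- ip c.1 (tdeg I))).
by rewrite big_cons ipDr (ipC (tdeg I) c.1); ring.
Qed.

(** Coassociativity of the unshuffle coproduct: both sides run over the
    decompositions of x into three subwords, with the same Koszul sign. *)
Lemma unsh_assoc (U : lmodType K) x (F : word -> word -> word -> U) :
  unsh x (fun I J => unsh I (fun I1 I2 => F I1 I2 J)) =
  unsh x (fun I J => unsh J (fun J1 J2 => F I J1 J2)).
Proof.
elim: x F => //= c x IH F.
rewrite -unshD IH -addrA; congr (_ + _).
under [RHS]unsh_eq => I J _ _ _ _ do rewrite scalerDr !unshZ.
rewrite -[RHS]unshD; congr (_ + _).
  exact: (IH (fun I J1 J2 => ksign K (ip c.1 (tdeg I)) *: F I (c :: J1) J2)).
rewrite -(IH (fun I J1 J2 => ksign K (ip c.1 (tdeg I)) *: (ksign K (ip c.1 (tdeg J1)) *: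
   F I J1 (c :: J2)))).
apply: unsh_eq => I J _ _ _ _; rewrite unshZ; apply: unsh_eq => I1 I2 _ _ _ dg.
by rewrite scalerA -ksignD -ipDr dg.
Qed.

Lemma unsh_nilr (U : lmodType K) x (F : word -> U) :
  unsh x (fun I J => if J is [::] then F I else 0) = F x.
Proof.
elim: x F => //= c x IH F; rewrite IH -[RHS]addr0; congr (_ + _).
rewrite (@unsh_eq _ x _ (fun _ _ => 0 *: 0)); first by rewrite -unshZ scale0r.
by move=> I J _ _ _ _; rewrite !scaler0.
Qed.

Lemma unsh_nill (U : lmodType K) x (F : word -> U) :
  unsh x (fun I J => if I is [::] then F J else 0) = F x.
Proof.
rewrite unsh_sym -[RHS](unsh_nilr x F); apply: unsh_eq => I [|d J] _ _ _ _.
  by rewrite big_nil ip0r ksign0 scale1r.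
by rewrite scaler0.
Qed.

Lemma unsh_multilinear (U : lmodType K) (C : zdeg n -> set W)
    (F : word -> word -> U) x y a k u v :
  (forall I1 I2 J, homog C I1 -> homog C I2 -> homog C J ->
     F (I1 ++ (a, k *: u + v) :: I2) J =
       k *: F (I1 ++ (a, u) :: I2) J + F (I1 ++ (a, v) :: I2) J) ->
  (forall I J1 J2, homog C I -> homog C J1 -> homog C J2 ->
     F I (J1 ++ (a, k *: u + v) :: J2) =
       k *: F I (J1 ++ (a, u) :: J2) + F I (J1 ++ (a, v) :: J2)) ->
  homog C x -> homog C y ->
  unsh (x ++ (a, k *: u + v) :: y) F =
    k *: unsh (x ++ (a, u) :: y) F + unsh (x ++ (a, v) :: y) F.
Proof.
move=> Fl Fr hx hy; elim: x F Fl Fr hx => [|c x IH] F Fl Fr hx /=.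
  rewrite scalerDr addrACA.
  have hS I : {subset I <= y} -> homog C I by move=> s d /s /hy.
  congr (_ + _); rewrite unshZ unshD; apply: unsh_eq => I J /hS hI /hS hJ _ _.
    by rewrite (Fl [::]).
  by rewrite (Fr _ [::]) // scalerDr !scalerA mulrC.
have hc : C c.1 c.2 by apply: hx; rewrite inE eqxx.
have hCC I : homog C I -> homog C (c :: I).
  by move=> hI d; rewrite inE => /orP [/eqP ->|/hI].
have hx' : homog C x by move=> d dx; apply: hx; rewrite inE dx orbT.
rewrite scalerDr addrACA; congr (_ + _); apply: IH => //.
- by move=> I1 I2 J h1 h2 h3; apply: (Fl (c :: I1)) => //; apply: hCC.
- by move=> I J1 J2 h1 h2 h3; apply: Fr => //; apply: hCC.
- move=> I1 I2 J h1 h2 h3; rewrite !big_cat !big_cons /= Fl //; last exact: hCC.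
  by rewrite scalerDr !scalerA mulrC.
- move=> I J1 J2 h1 h2 h3; rewrite (Fr _ (c :: J1)) //; last exact: hCC.
  by rewrite scalerDr !scalerA mulrC.
Qed.

End Unshuffles.

(** * The coderivation formula on words *)

Section Codersum.
Variables (n : nat) (K : fieldType) (W : lmodType K).
Notation word := (seq (zdeg n * W)).
Implicit Types (x y z I J u : word) (c : zdeg n * W).

(** The letter that replaces a subword J when the corestriction q, of weight Q,
    is applied to it. *)
Definition corletter (Q : zdeg n) (q : word -> W) J : zdeg n * W :=
  (tdeg J + Q, q J).

(** The coderivation of weight Q with corestrictions q, composed with F, at the
    reversed word r.  A summand of the explicit formula either keeps the last
    letter c of the word, or ends with q applied to a subword ending in c. *)
Fixpoint codersum_rev (Q : zdeg n) (q : word -> W) (U : lmodType K)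
    (r : word) (F : word -> U) : U :=
  if r is c :: r' then
    codersum_rev Q q r' (fun z => F (rcons z c)) +
    unsh (rev r') (fun I J => ksign K (ip Q (tdeg I)) *:
      F (rcons I (corletter Q q (rcons J c))))
  else 0.

Definition codersum Q q (U : lmodType K) x (F : word -> U) : U :=
  codersum_rev Q q (rev x) F.

Section Fixed.
Variables (Q : zdeg n) (q : word -> W).
Notation qq := (corletter Q q).
Notation cs := (codersum Q q).

Lemma codersum_rcons (U : lmodType K) u c (F : word -> U) :
  cs (rcons u c) F =
  cs u (fun z => F (rcons z c)) +
  unsh u (fun I J => ksign K (ip Q (tdeg I)) *: F (rcons I (qq (rcons J c)))).
Proof. by rewrite /codersum rev_rcons /= revK. Qed.

Lemma tdeg_rcons u c : tdeg (rcons u c) = tdeg u + c.1.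
Proof. by rewrite -cats1 big_cat big_seq1. Qed.

(** The words that occur in Q (x) have the form I q(J) y, where I, J and y share
    out the letters of x. *)
Lemma codersum_rel (U U' : lmodType K) (R : U -> U' -> Prop) x F G :
  lin_rel R ->
  (forall I J y, (0 < size J)%N ->
     {subset I <= x} -> {subset J <= x} -> {subset y <= x} ->
     (size I + size J + size y)%N = size x ->
     tdeg I + tdeg J + tdeg y = tdeg x ->
     R (F (I ++ qq J :: y)) (G (I ++ qq J :: y))) ->
  R (cs x F) (cs x G).
Proof.
move=> hR; elim/last_ind: x F G => [|u c IH] F G h; first by case: hR.
have subR I : {subset I <= u} -> {subset I <= rcons u c}.
  by move=> s d /s du; rewrite mem_rcons inE du orbT.
have subRR I : {subset I <= u} -> {subset rcons I c <= rcons u c}.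
  by move=> s d; rewrite !mem_rcons !inE => /orP [->//|/s ->]; rewrite orbT.
rewrite !codersum_rcons; apply: lin_relD => //.
  apply: IH => I J y J0 sI sJ sy sz dg; rewrite !rcons_cat /=; apply: h => //.
  - exact: subR.
  - exact: subR.
  - exact: subRR.
  - by rewrite !size_rcons addnS sz.
  - by rewrite !tdeg_rcons addrA dg.
apply: unsh_rel => // I J sI sJ sz dg; apply: lin_relZ => //.
rewrite -!cats1; apply: h => //.
- by rewrite cats1 size_rcons.
- exact: subR.
- by rewrite cats1; apply: subRR.
- by rewrite cats1 !size_rcons addn0 addnS sz.
- by rewrite cats1 big_nil addr0 !tdeg_rcons addrA dg.
Qed.

Lemma codersum_eq (U : lmodType K) x (F G : word -> U) :
  (forall I J y, (0 < size J)%N ->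
     {subset I <= x} -> {subset J <= x} -> {subset y <= x} ->
     (size I + size J + size y)%N = size x ->
     tdeg I + tdeg J + tdeg y = tdeg x ->
     F (I ++ qq J :: y) = G (I ++ qq J :: y)) ->
  cs x F = cs x G.
Proof. by apply: codersum_rel; apply: lin_rel_eq. Qed.

Lemma eq_codersum (U : lmodType K) x (F G : word -> U) :
  F =1 G -> cs x F = cs x G.
Proof. by move=> h; apply: codersum_eq => *; apply: h. Qed.

Lemma codersum_map (U U' : lmodType K) (L : U -> U') x F : linear L ->
  L (cs x F) = cs x (fun z => L (F z)).
Proof. by move=> Ll; apply: (codersum_rel (lin_rel_map Ll)). Qed.

Lemma codersumZ (U : lmodType K) k x (F : word -> U) :
  k *: cs x F = cs x (fun z => k *: F z).
Proof. by apply: codersum_map => a u v; rewrite scalerDr !scalerA mulrC. Qed.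

Lemma codersumD (U : lmodType K) x (F G : word -> U) :
  cs x F + cs x G = cs x (fun z => F z + G z).
Proof.
elim/last_ind: x F G => [|u c IH] F G; first exact: addr0.
rewrite !codersum_rcons addrACA IH unshD; congr (_ + _).
by apply: unsh_eq => I J _ _ _ _; rewrite scalerDr.
Qed.

(** The coderivation rule for the unshuffle coproduct.  Let x = u c.  The summands
    that keep c are treated by induction.  The others are indexed by the
    decompositions of u into three words, one of which is swallowed by q together
    with c: coassociativity identifies the two indexings when the new letter goes
    to the second factor, and cocommutativity is needed in addition when it goes
    to the first one, as c then crosses the second factor. *)
Lemma codersum_unsh (U : lmodType K) x (F : word -> word -> U) :
  cs x (fun z => unsh z F) =
  unsh x (fun I J => cs I (F^~ J)) +
  unsh x (fun I J => ksign K (ip Q (tdeg I)) *: cs J (F I)).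
Proof.
elim/last_ind: x F => [|u c IH] F; first by rewrite /= scaler0 addr0.
(* c goes to the first factor in F1 and to the second one in F2 *)
pose F1 I J := ksign K (ip c.1 (tdeg J)) *: F (rcons I c) J.
pose F2 I J := F I (rcons J c).
rewrite [LHS]codersum_rcons.
rewrite (eq_codersum _ (G := fun z => unsh z F1 + unsh z F2)); last first.
  by move=> z; rewrite unsh_rcons.
rewrite -codersumD !IH.
under [X in _ + _ + X]unsh_eq => A B _ _ _ _ do rewrite unsh_rcons scalerDr.
rewrite -[X in _ + _ + X]unshD.
rewrite !unsh_rcons.
under [X in _ = X + _ + _]unsh_eq => I J _ _ _ _ do rewrite codersum_rcons scalerDr.
under [X in _ = _ + (_ + X)]unsh_eq => I J _ _ _ _ do rewrite codersum_rcons scalerDr.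
rewrite -[X in _ = X + _ + _]unshD -[X in _ = _ + (_ + X)]unshD.
(* terms 5 and 6 of the left-hand side are those where q has swallowed c, the new
   letter being in the first and in the second factor *)
rewrite [LHS](AC (2*2*2) ((1*5*3)*(2*(4*6)))); congr (_ + _ + _ + (_ + (_ + _))).
- by apply: unsh_eq => I J _ _ _ _; rewrite codersumZ.
- transitivity (unsh u (fun A R => unsh R (fun A2 B => ksign K
      (ip Q (tdeg A) + ip Q (tdeg A2) + ip (tdeg B + c.1 + Q) (tdeg A2)) *:
        F (rcons A (qq (rcons B c))) A2))).
    rewrite -unsh_assoc; apply: unsh_eq => I J _ _ _ _; rewrite unshZ.
    apply: unsh_eq => A1 A2 _ _ _ dg; rewrite scalerA -ksignD -dg /= ipDr.
    by rewrite tdeg_rcons.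
  under [RHS]unsh_eq => I J _ _ _ _ do rewrite unshZ.
  rewrite (unsh_assoc _ (fun A B J => _)); apply: unsh_eq => A R _ _ _ _.
  rewrite unsh_sym; apply: unsh_eq => B A2 _ _ _ _.
  rewrite !scalerA -!ksignD; congr (_ *: _).
  apply: (@ksign_congr _ _ _ (ip Q (tdeg A2) + ip (tdeg B) (tdeg A2))).
  by rewrite !ipDl; ring.
- apply: unsh_eq => I J _ _ _ _; rewrite !codersumZ; apply: codersum_eq.
  move=> A B y _ _ _ _ _ dg; rewrite /F1 !scalerA -!ksignD; congr (_ *: _).
  apply: (@ksign_congr _ _ _ 0).
  rewrite tdeg_rcons -dg big_cat big_cons /= !ipDr (ipC c.1 Q); ring.
- transitivity (unsh u (fun A R => unsh R (fun A2 B => ksign K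
      (ip Q (tdeg A) + ip Q (tdeg A2)) *: F A (rcons A2 (qq (rcons B c)))))).
    rewrite -unsh_assoc; apply: unsh_eq => I J _ _ _ _; rewrite unshZ.
    by apply: unsh_eq => A1 A2 _ _ _ <-; rewrite ipDr.
  apply: unsh_eq => A R _ _ _ _; rewrite unshZ; apply: unsh_eq => A2 B _ _ _ _.
  by rewrite scalerA ksignD.
Qed.

End Fixed.
End Codersum.

(** * The coproduct and its kernel *)

Section Coproduct.
Variables (n : nat) (K : fieldType) (W : lmodType K) (gW : grading n W).
Notation word := (seq (zdeg n * W)).
Implicit Types (x y z I J u : word) (c : zdeg n * W).

(** Each entry of a tensor is a sum of homogeneous vectors. *)
Lemma tens_ext (U : lmodType K) (L L' : tensalg W -> U) :
  linear L -> linear L' ->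
  (forall x, homog gW x -> L (tens (vecs x)) = L' (tens (vecs x))) -> L =1 L'.
Proof.
move=> Ll Ll' h; suff hs s : L (tens s) = L' (tens s).
  elim/tensalg_ind => [|k s t IH]; first by rewrite !lin0.
  by rewrite Ll Ll' hs IH.
suff hx x : homog gW x -> L (tens (vecs x ++ s)) = L' (tens (vecs x ++ s)).
  by apply: (hx [::]) => c.
elim: s x => [|v s IH] x hx; first by rewrite cats0; apply: h.
rewrite -(hdec_sum gW v); have := @hdec_homog _ _ _ gW v.
elim: (hdec gW v) => [|c y IHy] hy.
  have t0 := lin0 (tens_lin (vecs x) s).
  by rewrite big_nil /= t0 !lin0.
have [hc hy'] := (homog_cons gW c y).1 hy.
rewrite big_cons (linD _ _ (tens_lin (vecs x) s)) !linD // IHy //.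
have := IH (rcons x c); rewrite /unzip2 map_rcons cat_rcons => -> //.
by move=> d; rewrite mem_rcons; apply: (homog_cons gW c x).2.
Qed.

Lemma big_tuple_cons (U : zmodType) N (f : seq bool -> U) :
  \sum_(m : N.+1.-tuple bool) f m =
  \sum_(m : N.-tuple bool) f (true :: m) + \sum_(m : N.-tuple bool) f (false :: m).
Proof.
rewrite (reindex (fun p : bool * N.-tuple bool => [tuple of p.1 :: p.2])) /=.
  rewrite -(pair_bigA _ (fun (b : bool) (m : N.-tuple bool) => f (b :: m))) /=.
  by rewrite big_bool.
exists (fun m : N.+1.-tuple bool => (thead m, [tuple of behead m])) => [[b m] _|m _] /=.
  by congr (_, _); apply: val_inj.
by rewrite -tuple_eta.
Qed.

Lemma kexp_cons b (m : seq bool) (a : zdeg n) (d : seq (zdeg n)) :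
  (size m <= size d)%N ->
  kexp (b :: m) (a :: d) =
  kexp m d + (if b then 0 else ip a (\sum_(e <- mask m d) e)).
Proof.
move=> sm; rewrite /kexp big_ord_recl big_ord0 add0r.
under eq_bigr => i _ do rewrite /= big_mkcond big_ord_recl /= -big_mkcond.
rewrite big_split /= addrC; congr (_ + _).
have -> : \sum_(e <- mask m d) e = \sum_(i < size m | nth false m i) nth 0 d i.
  elim: m d sm => [|[] m IH] [|e d] //= sm; rewrite ?big_ord0 ?big_nil //.
    by rewrite big_cons IH // [RHS]big_mkcond big_ord_recl /= -big_mkcond.
  by rewrite IH // [RHS]big_mkcond big_ord_recl /= -big_mkcond add0r.
case: b => /=; first by rewrite big1 // => i _; rewrite andbF.
rewrite [in RHS]big_mkcond.
rewrite (big_morph (ip a) (ipDr a) (ip0r a)); apply: eq_bigr => i _.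
by rewrite andbT; case: ifP => _; rewrite ?ip0r // ipC.
Qed.

(** Masks of u are subwords of u.  The suffix e is there because the sign of the
    coproduct is computed from the degrees of the whole word, last letter
    included. *)
Lemma sum_masks (U : lmodType K) (F : word -> word -> U) u e :
  \sum_(m : (size u).-tuple bool)
    ksign K (kexp m (degs (u ++ e))) *: F (mask m u) (mask (map negb m) u) =
  unsh u F.
Proof.
elim: u F => [|c u IH] F.
  rewrite (big_pred1 [tuple]) => [|m]; last by rewrite (tuple0 m) /= eqxx.
  by rewrite /kexp big_ord0 ksign0 scale1r.
rewrite (@big_tuple_cons _ (size u) (fun m => ksign K (kexp m (degs ((c :: u) ++ e))) *:
   F (mask m (c :: u)) (mask (map negb m) (c :: u)))) /=.
have sm (m : (size u).-tuple bool) : (size m <= size (degs (u ++ e)))%N.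
  by rewrite size_tuple size_map size_cat leq_addr.
congr (_ + _); rewrite -IH; apply: eq_bigr => m _; rewrite kexp_cons //.
  by rewrite addr0.
rewrite ksignD -scalerA; congr (_ *: (ksign K (ip _ _) *: _)).
have -> : mask m (degs (u ++ e)) = degs (mask m u).
  rewrite /unzip1 map_mask map_cat -{1}[m : seq bool]cats0.
  by rewrite mask_cat ?size_map ?size_tuple // mask0s cats0.
by rewrite big_map.
Qed.

(** The condition that I be nonempty is automatic, since the empty tensor is 0 in
    T(W). *)
Lemma coprod_rcons u c : homog gW (rcons u c) ->
  coprod gW (tens (vecs (rcons u c))) =
  unsh u (fun I J => tens2 (tens (vecs I)) (tens (vecs (rcons J c)))).
Proof.
move=> hx; rewrite (coprodP gW).2 // size_rcons /= -(sum_masks _ u [:: c]).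
rewrite [RHS](bigID (fun m : (size u).-tuple bool => has id m)) /=.
rewrite [X in _ = _ + X]big1 ?addr0; last first.
  move=> m hm; have -> : mask m u = [::].
    apply/nilP; rewrite /nilp size_mask ?size_tuple //.
    by move: hm; rewrite has_count lt0n negbK.
  by rewrite tens_nil (lin0 (tens2_linl _)) scaler0.
apply: eq_bigr => m _; rewrite cats1; congr (_ *: tens2 (tens _) (tens _)).
  rewrite /unzip2 map_mask map_rcons -cats1 -{1}[m : seq bool]cats0.
  by rewrite mask_cat ?size_map ?size_tuple // mask0s cats0.
by rewrite /unzip2 !map_rcons map_mask mask_rcons ?size_map ?size_tuple // cats1.
Qed.

(** Right multiplication by a letter, as a map on T(W) (x) T(W) which kills the
    tensors whose second factor has more than one letter: it turns the summand of
    the coproduct with empty J into the original word. *)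
Lemma exists_mulr : exists M : tensor (tensalg W) (tensalg W) -> tensalg W,
  linear M /\ forall s w t, M (tens2 (tens s) (tens (rcons t w))) =
    if t is [::] then if s is [::] then 0 else tens (rcons s w) else 0.
Proof.
have pr w : exists R : tensalg W -> tensalg W, linear R /\
    forall s, R (tens s) = if s is [::] then 0 else tens (rcons s w).
  apply: tens_lift => // s t k u v.
  have E a : (if s ++ a :: t is [::] then 0 else tens (rcons (s ++ a :: t) w)) =
      tens (s ++ a :: rcons t w) by rewrite -rcons_cons -rcons_cat; case: s.
  by rewrite !E tens_lin.
have [R /all_and2 [Rl RE]] := choice pr.
have Rlin t : linear (R^~ t).
  move=> k w w'; elim/tensalg_ind: t => [|b s t IH].
    by rewrite !(lin0 (Rl _)) scaler0 addr0.
  rewrite !Rl IH !RE; case: s => [|a s].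
    by rewrite !scaler0 !add0r.
  rewrite -!cats1 (tens_lin (a :: s) [::]) !scalerDr !scalerA (mulrC b) addrACA.
  by [].
have [pl pE] := @tproj1P K W.
have [||M [Ml ME]] := @tens2_lift K (tensalg W) (tensalg W) (tensalg W)
   (fun t t' => R (tproj1 t') t).
- by move=> v; apply: Rl.
- by move=> u k v v'; rewrite pl Rlin.
exists M; split=> // s w [|w' t]; rewrite ME pE /=; first by rewrite RE.
by case: t => [|? ?] /=; apply: (lin0 (Rlin _)).
Qed.

(** Any t is the sum of its component in W and of the image of its coproduct under
    the map of [exists_mulr]. *)
Lemma coprod_inj (t t' : tensalg W) :
  coprod gW t = coprod gW t' -> tproj1 t = tproj1 t' -> t = t'.
Proof.
have [M [Ml ME]] := exists_mulr; have [pl pE] := @tproj1P K W.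
have [dl _] := coprodP gW.
suff E : forall t, t = tens [:: tproj1 t] + M (coprod gW t).
  by move=> e1 e2; rewrite (E t) (E t') e1 e2.
apply: (@tens_ext _ id (fun t => tens [:: tproj1 t] + M (coprod gW t))) => //.
  move=> k a b; rewrite pl (tens_lin [::] [::]) dl Ml scalerDr.
  by rewrite addrACA.
elim/last_ind => [|u c _] hx; first
  by rewrite tens_nil (lin0 pl) (lin0 dl) (lin0 Ml) (lin0 (tens_lin [::] [::])) addr0.
rewrite coprod_rcons // (unsh_map _ _ Ml) pE.
rewrite (@unsh_eq _ _ _ _ _ _ (fun I J => if J is [::] then
   if I is [::] then 0 else tens (vecs (rcons I c)) else 0)); last first.
  move=> I J _ _ _ _; rewrite /unzip2 map_rcons ME; case: J => // ; case: I => // d I.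
  by rewrite /= map_rcons.
rewrite (unsh_nilr _ (fun I => if I is [::] then 0 else tens (vecs (rcons I c)))).
case: u hx => [|d [|d' u]] _ /=; rewrite ?addr0 //;
  by rewrite (lin0 (tens_lin [::] [::])) add0r.
Qed.

End Coproduct.

(** * Coderivations and their corestrictions *)

Section Coderivations.
Variables (n : nat) (K : fieldType) (W : lmodType K) (gW : grading n W).
Notation word := (seq (zdeg n * W)).
Implicit Types (x y z I J u : word) (c : zdeg n * W) (Q : zdeg n).

Lemma homog_sub x y : homog gW x -> {subset y <= x} -> homog gW y.
Proof. by move=> hx s d /s /hx. Qed.

Lemma homog_rcons u c : homog gW (rcons u c) <-> homog gW u /\ gW c.1 c.2.
Proof.
rewrite -cats1; split=> [/homog_cat [hu hc]|[hu hc]].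
  by split=> //; apply: hc; rewrite inE.
by apply/homog_cat; split=> // d; rewrite inE => /eqP ->.
Qed.

Lemma tcomp_tens x : homog gW x -> tcomp gW (tdeg x) (tens (vecs x)).
Proof.
move=> hx; rewrite -[tens _]scale1r -[_ *: _]addr0; apply: lspanD; last exact: lspan0.
by exists x.
Qed.

Lemma coder_rhs Q (D : tensalg W -> tensalg W) u c :
  linear D -> homog gW (rcons u c) ->
  let X := coprod gW (tens (vecs (rcons u c))) in
  tmap gW D id 0 X + tmap gW id D Q X =
  unsh u (fun I J =>
    tens2 (D (tens (vecs I))) (tens (vecs (rcons J c))) +
    ksign K (ip Q (tdeg I)) *:
      tens2 (tens (vecs I)) (D (tens (vecs (rcons J c))))).
Proof.
move=> Dl hx X; rewrite /X coprod_rcons //.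
have [hu hc] := (homog_rcons u c).1 hx.
have idl : linear (@id (tensalg W)) by [].
have [l1 e1] := tmapP gW 0 Dl idl; have [l2 e2] := tmapP gW Q idl Dl.
rewrite (unsh_map _ _ l1) (unsh_map _ _ l2) unshD.
apply: unsh_eq => I J /(homog_sub hu) hI _ _ _.
by rewrite (e1 _ _ _ (tcomp_tens hI)) (e2 _ _ _ (tcomp_tens hI)) ipC ip0r ksign0 scale1r.
Qed.

(** By induction on the length: in the coderivation rule for D (w_1 ... w_p), D is
    applied only to words of fewer than p letters, because both factors of the
    coproduct are nonempty. *)
Lemma coder_unique Q (D D' : tensalg W -> tensalg W) :
  coderivation gW Q D -> coderivation gW Q D' ->
  (forall x, homog gW x -> (0 < size x)%N ->
     tproj1 (D (tens (vecs x))) = tproj1 (D' (tens (vecs x)))) ->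
  D = D'.
Proof.
move=> [Dl _ Dc] [Dl' _ Dc'] h; apply: funext.
apply: (tens_ext (gW := gW)) => // x.
have [m] := ubnP (size x); elim: m x => // m IH x; case/lastP: x => [|u c].
  by rewrite tens_nil !lin0.
rewrite size_rcons ltnS => um hx; have [hu hc] := (homog_rcons u c).1 hx.
apply: (@coprod_inj _ _ _ gW); last by apply: h => //; rewrite size_rcons.
rewrite Dc Dc' !coder_rhs //; apply: unsh_eq => I J sI sJ sz _.
case: I sI sz => [|d I] sI sz.
  by rewrite tens_nil (lin0 Dl) (lin0 Dl') !(lin0 (tens2_linl _)).
have szI : (size (d :: I) <= size u)%N by rewrite -sz leq_addr.
have szJ : (size J < size u)%N by rewrite -sz addSn ltnS leq_addl.
rewrite (IH (d :: I)); last exact: homog_sub hu sI.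
  rewrite (IH (rcons J c)) ?size_rcons //; first exact: leq_ltn_trans szJ um.
  by apply/homog_rcons; split=> //; apply: homog_sub hu sJ.
exact: leq_ltn_trans szI um.
Qed.

(** Multilinearity on words of homogeneous letters; unlike [hmultilinear], it
    allows any value at the empty word, and so is inherited by the functions
    z |-> F (z c). *)
Definition multihomog (U : lmodType K) (F : word -> U) :=
  forall x y a k (u v : W), homog gW x -> homog gW y -> gW a u -> gW a v ->
    F (x ++ (a, k *: u + v) :: y) = k *: F (x ++ (a, u) :: y) + F (x ++ (a, v) :: y).

Lemma multihomog0 (U : lmodType K) (F : word -> U) x y a :
  multihomog F -> homog gW x -> homog gW y -> F (x ++ (a, 0) :: y) = 0.
Proof.
move=> Fm hx hy; have := Fm x y a (-1) 0 0 hx hy (comp0 gW a) (comp0 gW a).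
by rewrite scaler0 addr0 scaleN1r addNr.
Qed.

Lemma tens_multihomog : multihomog (fun x => tens (vecs x)).
Proof.
move=> x y a k u v _ _ _ _; rewrite /unzip2 !map_cat /=; exact: tens_lin.
Qed.

Section Corestriction.
Variables (Q : zdeg n) (q : word -> W).
Hypotheses (q_deg : forall x, homog gW x -> (0 < size x)%N -> gW (tdeg x + Q) (q x))
           (q_lin : multihomog q).

Lemma corletter_homog I J y : homog gW I -> homog gW J -> homog gW y ->
  (0 < size J)%N -> homog gW (I ++ corletter Q q J :: y).
Proof.
move=> hI hJ hy J0; apply/homog_cat; split=> //.
by apply/homog_cons; split=> //; apply: q_deg.
Qed.

Lemma codersum_multihomog (U : lmodType K) (F : word -> U) :
  multihomog F -> multihomog (fun x => codersum Q q x F).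
Proof.
move=> Fm x y a k u v hx hy gu gv.
have gkuv : gW a (k *: u + v) by apply: comp_lin.
elim/last_ind: y F Fm hy => [|y c IH] F Fm hy.
  rewrite !cats1 !codersum_rcons scalerDr addrACA; congr (_ + _).
    rewrite codersumZ codersumD; apply: codersum_eq => I J y J0 sI sJ sy _ _.
    rewrite -!cats1; apply: Fm => //.
    by apply: corletter_homog => //; exact: homog_sub hx _.
  rewrite unshZ unshD; apply: unsh_eq => I J sI sJ _ _.
  have hI := homog_sub hx sI; have hJ := homog_sub hx sJ.
  rewrite -!cats1 /corletter q_lin // !big_cat !big_cons !big_nil /= Fm //.
  - by rewrite scalerDr !scalerA mulrC.
  - have := @q_deg (rcons J (a, u)); rewrite tdeg_rcons size_rcons -cats1 addr0.
    by apply=> //; rewrite cats1; apply/homog_rcons.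
  - have := @q_deg (rcons J (a, v)); rewrite tdeg_rcons size_rcons -cats1 addr0.
    by apply=> //; rewrite cats1; apply/homog_rcons.
have [hy' hc] := (homog_rcons y c).1 hy.
rewrite -!rcons_cons -!rcons_cat !codersum_rcons scalerDr addrACA; congr (_ + _).
  apply: IH => // x' y' b k' u' v' hx' hy'' gu' gv'.
  by rewrite !rcons_cat !rcons_cons; apply: Fm => //; apply/homog_rcons.
apply: (@unsh_multilinear _ _ _ _ gW) => //.
  move=> I1 I2 J h1 h2 hJ; rewrite !rcons_cat !rcons_cons Fm //; last first.
    apply/homog_rcons; split=> //; apply: q_deg; rewrite ?size_rcons //.
    exact/homog_rcons.
  by rewrite !big_cat !big_cons /= scalerDr !scalerA mulrC.
move=> I J1 J2 hI h1 h2; rewrite !rcons_cat !rcons_cons.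
have hJ w : gW a w -> homog gW (J1 ++ (a, w) :: rcons J2 c).
  move=> gw; apply/homog_cat; split=> //; apply/homog_cons; split=> //.
  exact/homog_rcons.
have gq w : gW a w ->
    gW (tdeg J1 + (a + tdeg (J2 ++ [:: c])) + Q) (q (J1 ++ (a, w) :: J2 ++ [:: c])).
  move=> gw; have := q_deg (hJ w gw); rewrite big_cat big_cons cats1 /=; apply.
  by rewrite size_cat /= addnS.
rewrite {1}/corletter q_lin //; last exact/homog_rcons.
rewrite -!cats1 !big_cat !big_cons /= Fm //; try exact: gq.
by rewrite scalerDr !scalerA mulrC !cats1 /corletter !big_cat !big_cons.
Qed.

(** The words I q(J) y of Q (x) have a single letter only if J is x. *)
Lemma codersum_proj x : (0 < size x)%N ->
  tproj1 (codersum Q q x (fun z => tens (vecs z))) = q x.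
Proof.
have [pl pE] := @tproj1P K W.
case/lastP: x => // u c _; rewrite codersum_rcons (linD _ _ pl).
rewrite (codersum_map _ _ _ _ pl) (unsh_map _ _ pl).
rewrite (@codersum_eq _ _ _ _ _ _ _ _ (fun=> 0 *: 0)); last first.
  move=> I J y _ _ _ _ _ _; rewrite /unzip2 map_rcons map_cat /= pE scaler0.
  by case: I => [|? []] //=; case: y.
rewrite -codersumZ scale0r add0r.
rewrite (@unsh_eq _ _ _ _ _ _ (fun I J => if I is [::] then q (rcons J c) else 0)).
  exact: (unsh_nill _ (fun J => q (rcons J c))).
move=> I J _ _ _ _; rewrite (linZ _ _ pl) pE /unzip2 map_rcons.
case: I => [|? [|? ?]] /=; rewrite ?scaler0 //.
by rewrite big_nil ip0r ksign0 scale1r.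
Qed.

(** Let x = u c.  As Delta (z c) is the unshuffle coproduct of z with c appended to
    the second factors, the words of Q (x) that keep c are handled by
    [codersum_unsh] for u.  Those that end with q applied to c and a part of u are,
    by coassociativity, the part of the second factor Q (u'' c) where q has
    swallowed c. *)
Lemma coder_exists : exists D, coderivation gW Q D /\
  forall x, homog gW x ->
    D (tens (vecs x)) = codersum Q q x (fun z => tens (vecs z)).
Proof.
pose F x := codersum Q q x (fun z => tens (vecs z)).
have [|Dl DE] := @linextP n K W gW _ F.
  by split=> //; apply: codersum_multihomog; apply: tens_multihomog.
exists (linext gW F); split=> //; split=> //.
  move=> a t; elim=> [|k s t' [x [hx <- ->]] _ IH].
    by rewrite lin0 //; apply: lspan0.
  rewrite Dl DE //; apply: lspanP => //.
  apply: (@codersum_rel _ _ _ _ _ _ _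
    (fun t (_ : tensalg W) => tcomp gW (tdeg x + Q) t) x _ (fun=> 0)).
    by split=> [|k' t1 t2 _ _]; [apply: lspan0 | apply: lspanP].
  move=> I J y J0 sI sJ sy _ dg.
  have -> : tdeg x + Q = tdeg (I ++ corletter Q q J :: y).
    by rewrite -dg big_cat big_cons /= -!addrA; congr (_ + (_ + _)); rewrite addrC.
  by apply: tcomp_tens; apply: corletter_homog => //; apply: homog_sub hx _.
have [dl dE] := coprodP gW.
have idl : linear (@id (tensalg W)) by [].
have [l0 _] := tmapP gW 0 Dl idl; have [lQ _] := tmapP gW Q idl Dl.
apply: (tens_ext (gW := gW)) => [k t t'|k t t'|]; first by rewrite Dl dl.
  by rewrite dl l0 lQ scalerDr addrACA.
move=> x; case/lastP: x => [|u c] hx.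
  by rewrite tens_nil !(lin0 Dl, lin0 dl, lin0 l0, lin0 lQ) addr0.
rewrite coder_rhs //; have [hu hc] := (homog_rcons u c).1 hx.
rewrite DE // /F (codersum_map _ _ _ _ dl) codersum_rcons.
rewrite (@codersum_eq _ _ _ _ _ _ _ _ (fun z =>
   unsh z (fun I J => tens2 (tens (vecs I)) (tens (vecs (rcons J c)))))); last first.
  move=> I J y J0 sI sJ sy _ _; apply: coprod_rcons; apply/homog_rcons; split=> //.
  by apply: corletter_homog => //; apply: homog_sub hu _.
rewrite codersum_unsh -unshD -addrA; congr (_ + _).
  apply: unsh_eq => I J sI sJ _ _; rewrite DE; last exact: homog_sub hu sI.
  by rewrite -(codersum_map _ _ _ _ (tens2_linl _)).
under [RHS]unsh_eq => I J sI sJ _ _.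
  rewrite DE; last by apply/homog_rcons; split=> //; apply: homog_sub hu _.
  rewrite /F codersum_rcons (linD _ _ (tens2_linr _)) scalerDr.
  rewrite (codersum_map _ _ _ _ (tens2_linr _)) (unsh_map _ _ (tens2_linr _)) unshZ.
  over.
rewrite -[RHS]unshD; congr (_ + _).
rewrite -(unsh_assoc _ (fun I A B => _)).
apply: unsh_eq => I J sI sJ _ _.
rewrite coprod_rcons; last first.
  apply/homog_rcons; split; first exact: homog_sub hu _.
  apply: q_deg; rewrite ?size_rcons //; apply/homog_rcons; split=> //.
  exact: homog_sub hu _.
rewrite unshZ; apply: unsh_eq => A B _ _ _ dg.
by rewrite (linZ _ _ (tens2_linr _)) scalerA -ksignD -ipDr dg.
Qed.

End Corestriction.
End Coderivations.

(** * Commutators and the length of words *)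

Section Commutators.
Variables (n : nat) (K : fieldType) (W : lmodType K) (gW : grading n W).
Notation word := (seq (zdeg n * W)).
Implicit Types (x y z I J u : word) (c : zdeg n * W) (Q : zdeg n).

(** The coproduct takes its values in the span of the s (x) t with s homogeneous,
    where tensor products of maps are known. *)
Lemma tensor_ext_coprod (U : lmodType K) (L L' : tensor (tensalg W) (tensalg W) -> U) :
  linear L -> linear L' ->
  (forall a s t, tcomp gW a s -> L (tens2 s t) = L' (tens2 s t)) ->
  forall t, L (coprod gW t) = L' (coprod gW t).
Proof.
move=> Ll Ll' h; have [dl _] := coprodP gW.
apply: (tens_ext (gW := gW)); try exact: lin_comp.
move=> x; case/lastP: x => [|u c] hx.
  by rewrite tens_nil (lin0 dl) (lin0 Ll) (lin0 Ll').
have [hu hc] := (homog_rcons gW u c).1 hx.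
rewrite coprod_rcons // (unsh_map _ _ Ll) (unsh_map _ _ Ll').
apply: unsh_eq => I J sI _ _ _; apply: h; apply: tcomp_tens; exact: homog_sub hu sI.
Qed.

(** The terms t2 and t3 stand for Dx (x) D'y and D'x (x) Dy, which occur in both
    orders of composition and disappear from the graded commutator. *)
Lemma cancel_cross (U : lmodType K) (k a g : K) (t1 t2 t3 t4 t1' t4' : U) :
  k * k = 1 ->
  t1 + a *: t2 + ((g * k) *: t3 + (a * g) *: t4) -
    k *: (t1' + g *: t3 + ((a * k) *: t2 + (g * a) *: t4')) =
  t1 - k *: t1' + (g * a) *: (t4 - k *: t4').
Proof.
move=> kk; rewrite !scalerDr !scalerA mulrCA kk mulr1 scalerN scalerA.
rewrite (mulrC g k) (mulrC a g) [k * (g * a)]mulrC !opprD.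
rewrite [LHS](AC (2*2*(2*2)) ((1*5)*(4*8)*((2*7)*(3*6)))).
by rewrite /= !subrr !addr0.
Qed.

(** Both sides are linear in the coproduct, so that it is enough to compare them on
    s (x) y; there D D' (x) id and id (x) D D' combine with their opposites and the
    mixed terms cancel. *)
Lemma gcomm_coder Q Q' (D D' : tensalg W -> tensalg W) :
  coderivation gW Q D -> coderivation gW Q' D' ->
  coderivation gW (Q + Q') (gcomm Q Q' D D').
Proof.
move=> [Dl Dw Dc] [Dl' Dw' Dc']; set k := ksign K (ip Q Q').
have Gl : linear (gcomm Q Q' D D').
  have -> : gcomm Q Q' D D' = fun t => D (D' t) + (- k) *: D' (D t).
    by apply: funext => t; rewrite scaleNr.
  by apply: lin_add; [|apply: lin_scale]; apply: lin_comp.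
have idl : linear (@id (tensalg W)) by [].
split=> // [a t ht|].
  rewrite /gcomm [_ - _]addrC -scaleNr; apply: lspanP.
    by rewrite addrA; apply/Dw'/Dw.
  by rewrite addrA addrAC; apply/Dw/Dw'.
have [dl _] := coprodP gW.
have [Al Ae] := tmapP gW 0 Dl idl; have [Bl Be] := tmapP gW Q idl Dl.
have [Al' Ae'] := tmapP gW 0 Dl' idl; have [Bl' Be'] := tmapP gW Q' idl Dl'.
have [Cl Ce] := tmapP gW 0 Gl idl; have [El Ee] := tmapP gW (Q + Q') idl Gl.
set A := tmap gW D id 0 in Al Ae; set B := tmap gW id D Q in Bl Be.
set A' := tmap gW D' id 0 in Al' Ae'; set B' := tmap gW id D' Q' in Bl' Be'.
move=> t; rewrite [in LHS]/gcomm -scaleNr addrC dl Dc Dc' Dc Dc'.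
rewrite -/A -/B -/A' -/B'.
pose L X := - k *: (A' (A X + B X) + B' (A X + B X)) +
              (A (A' X + B' X) + B (A' X + B' X)).
pose R X := tmap gW (gcomm Q Q' D D') id 0 X +
            tmap gW id (gcomm Q Q' D D') (Q + Q') X.
have LA : linear (fun X => A X + B X) by apply: lin_add.
have LA' : linear (fun X => A' X + B' X) by apply: lin_add.
rewrite -[LHS]/(L _) -[RHS]/(R _).
apply: (tensor_ext_coprod (L := L) (L' := R)).
- apply: lin_add; last by apply: lin_add; apply: (lin_comp _ LA').
  by apply: lin_scale; apply: lin_add; apply: (lin_comp _ LA).
- exact: lin_add.
move=> a s y hs; have hs1 := Dw _ _ hs; have hs2 := Dw' _ _ hs.
have k1 : k * k = 1 by apply: ksign_sqr.
rewrite /L /R (Ae _ _ _ hs) (Be _ _ _ hs) (Ae' _ _ _ hs) (Be' _ _ _ hs).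
rewrite (Ce _ _ _ hs) (Ee _ _ _ hs) !(ipC 0) !ip0r !ksign0 !scale1r.
rewrite !(linD _ _ Al, linD _ _ Bl, linD _ _ Al', linD _ _ Bl').
rewrite !(linZ _ _ Al, linZ _ _ Bl, linZ _ _ Al', linZ _ _ Bl').
rewrite (Ae _ _ _ hs) (Be _ _ _ hs) (Ae' _ _ _ hs) (Be' _ _ _ hs).
rewrite (Ae _ _ _ hs2) (Be _ _ _ hs2) (Ae' _ _ _ hs1) (Be' _ _ _ hs1).
rewrite !(ipC 0) !ip0r !ksign0 !scale1r scaleNr addrC.
rewrite !ipDr !ipDl !ksignD (ipC Q' Q) -/k !scalerA.
rewrite cancel_cross //; congr (_ + _).
  by rewrite /gcomm (linBZ _ _ _ (tens2_linl y)).
by congr (_ *: _); rewrite /gcomm (linBZ _ _ _ (tens2_linr s)).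
Qed.

Lemma coder0 Q : coderivation gW Q (fun=> 0).
Proof.
have zl : linear (fun _ : tensalg W => 0 : tensalg W).
  by move=> k u v; rewrite scaler0 addr0.
have idl : linear (@id (tensalg W)) by [].
have [l0 e0] := tmapP gW 0 zl idl; have [lQ eQ] := tmapP gW Q idl zl.
have dl := (coprodP gW).1.
split=> // [a t _|t]; first exact: lspan0.
rewrite (lin0 dl).
apply: (@tensor_ext_coprod _ (fun=> 0)
  (fun X => tmap gW (fun=> 0) id 0 X + tmap gW id (fun=> 0) Q X)).
- by move=> k u v; rewrite scaler0 addr0.
- exact: lin_add.
move=> a s y hs; rewrite (e0 _ _ _ hs) (eQ _ _ _ hs).
by rewrite (lin0 (tens2_linl _)) (lin0 (tens2_linr _)) !scaler0 addr0.
Qed.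

Section Support.
Variables (Q : zdeg n).

(** Replacing r letters by one shortens a word by r - 1; subwords of other lengths
    produce a zero letter. *)
Lemma codersum_support (q : word -> W) r (U : lmodType K) (F G : word -> U) x :
  (forall z, size z != r -> q z = 0) ->
  multihomog gW F -> multihomog gW G ->
  (forall z, (size z + r)%N = (size x).+1 -> F z = G z) ->
  homog gW x -> codersum Q q x F = codersum Q q x G.
Proof.
move=> qr Fm Gm FG hx; apply: codersum_eq => I J y _ sI sJ sy sz _.
have [rJ|] := eqVneq (size J) r.
  by apply: FG; rewrite size_cat /= -rJ -sz addnS addSn addnAC.
move=> /qr q0; rewrite /corletter q0.
by rewrite !(multihomog0 (gW := gW)) //; apply: homog_sub hx _.
Qed.

Definition restrict_arity (q : word -> W) r z : W := if size z == r then q z else 0.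

(** Each summand of the coderivation formula applies q only once, so that it is
    additive in q. *)
Lemma codersum_split (q : word -> W) (U : lmodType K) N (F : word -> U) x :
  multihomog gW F -> homog gW x -> (size x <= N)%N ->
  codersum Q q x F = \sum_(1 <= r < N.+1) codersum Q (restrict_arity q r) x F.
Proof.
elim/last_ind: x F => [|u c IH] F Fm hx uN; first by rewrite big1.
have [hu hc] := (homog_rcons gW u c).1 hx; rewrite size_rcons in uN.
under eq_bigr => r _ do rewrite codersum_rcons.
rewrite codersum_rcons big_split /=; congr (_ + _).
  apply: IH => //; last exact: ltnW.
  move=> x y a k v w hx' hy gv gw; rewrite !rcons_cat !rcons_cons.
  by apply: Fm => //; apply/homog_rcons.
rewrite unsh_sum; apply: unsh_eq => I J sI sJ sz _.
rewrite (bigD1_seq (size J).+1) ?iota_uniq //=; last first.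
  by rewrite mem_index_iota /= ltnS (leq_trans _ uN) // ltnS -sz leq_addl.
rewrite [X in _ + X]big1 => [|r rJ]; last first.
  rewrite /corletter /restrict_arity size_rcons eq_sym (negPf rJ) -cats1.
  by rewrite (multihomog0 (gW := gW)) ?scaler0 //; apply: homog_sub hu _.
by rewrite addr0 /corletter /restrict_arity size_rcons eqxx.
Qed.

End Support.
End Commutators.

(** * Desuspension and the stem bracket *)

Section Loday.
Variables (n : nat) (K : fieldType) (V : lmodType K) (gV : grading n V).
Notation word := (seq (zdeg n * V)).
Notation gW := (desusp gV).
Notation e1 := (e1 n).
Implicit Types (x y z I J : word) (Q A B : zdeg n) (pi : nat -> seq V -> V).

Lemma tdeg_shift x d : tdeg [seq (c.1 + d, c.2) | c <- x] = tdeg x + d *+ size x.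
Proof.
rewrite big_map big_split /=; congr (_ + _).
by elim: x => [|c x IH]; rewrite ?big_nil // big_cons IH mulrS.
Qed.

Lemma vecs_shift x d : vecs [seq (c.1 + d, c.2) | c <- x] = vecs x.
Proof. by rewrite /unzip2 -map_comp. Qed.

(** Passing from V to its desuspension lowers the degree of each of the a + 1
    arguments by e1 but also that of the value, which adds a e1 to the weight. *)
Lemma mmaps_desusp A a (f : seq V -> V) : mmaps gV A a f <->
  [/\ forall s, size s != a.+1 -> f s = 0,
      forall s t, linear (fun v => f (s ++ v :: t)) &
      forall x, homog gW x -> size x = a.+1 ->
        gW (tdeg x + (A + a%:Z *: e1)) (f (vecs x))].
Proof.
split=> [] [f0 fl fw]; split=> // x hx sx.
  have := fw [seq (c.1 + e1, c.2) | c <- x]; rewrite size_map vecs_shift tdeg_shift sx.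
  rewrite /desusp_comp /= /desusp_comp -natz scaler_nat -!addrA [_ *+ a + _]addrC -mulrS.
  by rewrite [A + _]addrC; apply=> // c /mapP [d /hx hd ->].
have := fw [seq (c.1 - e1, c.2) | c <- x]; rewrite size_map vecs_shift tdeg_shift sx.
rewrite /= /desusp_comp -natz scaler_nat -!addrA [_ *+ a + _]addrC -mulrS.
rewrite [A + _]addrC mulNrn addKr.
by apply=> // c /mapP [d /hx hd ->]; rewrite /= /desusp_comp subrK.
Qed.

Lemma weight_arityK A a : A + (1 - a.+1%:Z) *: e1 + a%:Z *: e1 = A.
Proof. by rewrite intS opprD addrA subrr add0r scaleNr subrK. Qed.

Lemma arity_weightK A a : A + a%:Z *: e1 + (1 - a.+1%:Z) *: e1 = A.
Proof. by rewrite addrAC weight_arityK. Qed.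

(** The corestriction of phi pi, (-1)^(p (p - 1) / 2) down o pi_p o up^p on words of
    p letters of the desuspension. *)
Definition corestr pi x : V :=
  ksign K ((size x * (size x).-1)./2)%:Z *:
    (ksign K (upexp (degs x)) *: pi (size x) (vecs x)).

Lemma corestr_inj pi pi' x : corestr pi x = corestr pi' x ->
  pi (size x) (vecs x) = pi' (size x) (vecs x).
Proof. by move=> /(can_inj (@ksignK _ _ _)) /(can_inj (@ksignK _ _ _)). Qed.

Lemma cochain_map Q pi p : cochains gV Q pi -> (0 < p)%N ->
  [/\ forall s, size s != p -> pi p s = 0,
      forall s t, linear (fun v => pi p (s ++ v :: t)) &
      forall x, homog gW x -> size x = p -> gW (tdeg x + Q) (pi p (vecs x))].
Proof.
case: p => // p [_ /(_ p.+1 isT)/mmaps_desusp [h1 h2 h3]] _; split=> //.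
by move: h3; rewrite weight_arityK.
Qed.

Lemma comp_scale a k (v : V) : gW a v -> gW a (k *: v).
Proof. by move=> gv; rewrite -[_ *: _]addr0; apply: comp_lin => //; apply: comp0. Qed.

Lemma corestr_deg Q pi : cochains gV Q pi -> forall x, homog gW x -> (0 < size x)%N ->
  gW (tdeg x + Q) (corestr pi x).
Proof.
move=> hpi x hx x0; have [_ _ hw] := cochain_map hpi x0.
by do 2! apply: comp_scale; apply: hw.
Qed.

Lemma corestr_multihomog Q pi : cochains gV Q pi -> multihomog gW (corestr pi).
Proof.
move=> hpi x y a k u v _ _ _ _.
have E w : [/\ size (x ++ (a, w) :: y) = (size x + size y).+1,
    degs (x ++ (a, w) :: y) = degs x ++ a :: degs y &
    vecs (x ++ (a, w) :: y) = vecs x ++ w :: vecs y].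
  by rewrite size_cat addnS /unzip1 /unzip2 !map_cat.
have Ew w : corestr pi (x ++ (a, w) :: y) =
   ksign K (((size x + size y).+1 * (size x + size y).+1.-1)./2)%:Z *:
    (ksign K (upexp (degs x ++ a :: degs y)) *:
      pi (size x + size y).+1 (vecs x ++ w :: vecs y)).
  by rewrite /corestr; have [-> -> ->] := E w.
have [_ hl _] := cochain_map hpi (ltn0Sn (size x + size y)).
by rewrite !Ew hl !scalerDr !scalerA mulrA [k * _]mulrC -!mulrA [k * _]mulrC.
Qed.

(** [phi] is specified by its corestrictions; [coder_exists] provides a coderivation
    with this specification and [coder_unique] identifies it with [phi]. *)
Lemma phi_coder Q pi : cochains gV Q pi -> coderivation gW Q (phi gV Q pi) /\
  forall x, homog gW x ->
    phi gV Q pi (tens (vecs x)) =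
    codersum Q (corestr pi) x (fun z => tens (vecs z)).
Proof.
move=> hpi.
have [D [cD DE]] := coder_exists (corestr_deg hpi) (corestr_multihomog hpi).
have hD x : homog gW x -> (0 < size x)%N -> tproj1 (D (tens (vecs x))) = corestr pi x.
  by move=> hx x0; rewrite DE // codersum_proj.
suff -> : phi gV Q pi = D by [].
rewrite /phi; set P := [set _ | _].
have [cD' hD'] : P (xget (fun=> 0) P).
  apply: (xgetPex (fun=> 0)); exists D; split=> // p x p0 sx hx.
  by rewrite hD ?sx // /corestr sx.
apply: (coder_unique cD' cD) => x hx x0.
by rewrite (hD' (size x)) // hD.
Qed.

Lemma phi_proj Q pi x : cochains gV Q pi -> homog gW x -> (0 < size x)%N ->
  tproj1 (phi gV Q pi (tens (vecs x))) = corestr pi x.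
Proof. by move=> /phi_coder [_ E] hx x0; rewrite E // codersum_proj. Qed.

Lemma multilinear_ext p (f g : seq V -> V) :
  (forall s, size s != p.+1 -> f s = 0) -> (forall s, size s != p.+1 -> g s = 0) ->
  (forall s t, linear (fun v => f (s ++ v :: t))) ->
  (forall s t, linear (fun v => g (s ++ v :: t))) ->
  (forall x, homog gW x -> size x = p.+1 -> f (vecs x) = g (vecs x)) ->
  f = g.
Proof.
move=> f0 g0 fl gl fg; apply: funext => s.
have [L [Ll LE]] := tens_lift (f0 [::] isT) fl.
have [M [Ml ME]] := tens_lift (g0 [::] isT) gl.
rewrite -LE -ME; apply: (tens_ext (gW := gW)) => // x hx; rewrite LE ME.
have [sx|nx] := eqVneq (size x) p.+1; first exact: fg.
by rewrite f0 ?g0 // size_map.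
Qed.

Lemma cochain_ext Q Q' pi pi' p : cochains gV Q pi -> cochains gV Q' pi' -> (0 < p)%N ->
  (forall x, homog gW x -> size x = p -> corestr pi x = corestr pi' x) ->
  pi p = pi' p.
Proof.
case: p => // p hpi hpi' _ h.
have [h1 h2 _] := cochain_map hpi (ltn0Sn p).
have [h1' h2' _] := cochain_map hpi' (ltn0Sn p).
by apply: (multilinear_ext h1 h1' h2 h2') => x hx sx; rewrite -sx; apply/corestr_inj/h.
Qed.

Lemma tproj1_comp a (t : tensalg V) : tcomp gW a t -> gW a (tproj1 t).
Proof.
have [pl pE] := @tproj1P K V.
elim=> [|k s t' [x [hx <- ->]] _ IH]; first by rewrite (lin0 pl); apply: comp0.
rewrite pl; apply: comp_lin => //; rewrite pE.
case: x hx {IH} => [|c [|d x]] hx /=; try exact: comp0.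
by rewrite big_seq1; apply: hx; rewrite inE.
Qed.

(** The signs that relate a cochain to its corestrictions are involutive, so the
    cochain of D is obtained by multiplying the corestrictions of D by the same
    signs. *)
Lemma phi_surj Q D : coderivation gW Q D ->
  exists2 pi, cochains gV Q pi & phi gV Q pi = D.
Proof.
move=> cD; have [Dl Dw _] := cD; have [pl _] := @tproj1P K V.
pose F p x := if size x == p then
   ksign K ((size x * (size x).-1)./2)%:Z *:
    (ksign K (upexp (degs x)) *: tproj1 (D (tens (vecs x)))) else 0.
pose pi p s := if (0 < p)%N && (size s == p) then linext gW (F p) (tens s) else 0.
have LP p : (0 < p)%N -> linear (linext gW (F p)) /\
    forall x, homog gW x -> linext gW (F p) (tens (vecs x)) = F p x.
  move=> p0; apply: linextP; split=> [|x y a k u v hx hy gu gv].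
    by rewrite /F; case: p p0.
  rewrite /F !size_cat /=; case: ifP => _; last by rewrite scaler0 addr0.
  rewrite /unzip1 /unzip2 !map_cat /= tens_lin Dl pl.
  by rewrite !scalerDr !scalerA mulrA [k * _]mulrC -!mulrA [k * _]mulrC.
have piE x : homog gW x -> (0 < size x)%N -> corestr pi x = tproj1 (D (tens (vecs x))).
  move=> hx x0; rewrite /corestr /pi x0 size_map eqxx (LP _ x0).2 // /F eqxx.
  rewrite [ksign K (upexp _) *: (_ *: _)]scalerA.
  by rewrite [_ * ksign K _%:Z]mulrC -scalerA !ksignK.
have hpi : cochains gV Q pi.
  split=> // p p0; case: p p0 => // p _; apply/mmaps_desusp; split.
  - by move=> s /negPf ns; rewrite /pi ns andbF.
  - move=> s t k u v; rewrite /pi !size_cat /=.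
    case: ifP => _; last by rewrite scaler0 addr0.
    by rewrite tens_lin (LP _ (ltn0Sn p)).1.
  move=> x hx sx.
  rewrite weight_arityK /pi size_map sx eqxx (LP _ (ltn0Sn p)).2 // /F sx eqxx.
  do 2! apply: comp_scale; apply: tproj1_comp; apply: Dw; exact: tcomp_tens.
exists pi => //; apply: (coder_unique (phi_coder hpi).1 cD) => x hx x0.
by rewrite phi_proj // piE.
Qed.

Lemma phi_bij Q : set_bij (cochains gV Q) (coderivation gW Q) (phi gV Q).
Proof.
split=> [pi hpi|pi pi' /set_mem hpi /set_mem hpi' e|D cD]; first exact: (phi_coder hpi).1.
  apply: funext => -[|p]; first by rewrite hpi.1 hpi'.1.
  apply: (cochain_ext hpi hpi') => // x hx sx.
  by rewrite -(phi_proj hpi) -?(phi_proj hpi') ?sx ?e.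
by have [pi hpi <-] := phi_surj cD; exists pi.
Qed.

Definition single a (f : seq V -> V) : nat -> seq V -> V :=
  fun p => if p == a.+1 then f else 0.

Lemma single_cochain A a f : mmaps gV A a f -> cochains gV (A + a%:Z *: e1) (single a f).
Proof.
move=> hf; split=> // p p0; rewrite /single; case: eqP => [->|_] /=.
  by rewrite arity_weightK.
split=> // [s t k u v|x _ _]; first by rewrite scaler0 addr0.
exact: comp0.
Qed.

Lemma corestr_single a f x : size x != a.+1 -> corestr (single a f) x = 0.
Proof. by move=> /negPf nx; rewrite /corestr /single nx !scaler0. Qed.

(** A coderivation with corestrictions in arity a + 1 only comes from a single
    multilinear map, by surjectivity of [phi]. *)
Lemma phi1_invP A a D : coderivation gW (A + a%:Z *: e1) D ->
  (forall x, homog gW x -> (0 < size x)%N -> size x != a.+1 ->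
     tproj1 (D (tens (vecs x))) = 0) ->
  mmaps gV A a (phi1_inv gV A a D) /\ phi1 gV A a (phi1_inv gV A a D) = D.
Proof.
move=> /phi_surj [pi hpi <-] h; rewrite /phi1_inv; set P := [set _ | _].
suff : exists f, P f by move=> /(xgetPex 0).
have hf : mmaps gV A a (pi a.+1).
  by have := hpi.2 a.+1 isT; rewrite arity_weightK.
exists (pi a.+1); split=> //; rewrite /phi1 -/(single a (pi a.+1)); congr phi.
apply: funext => p; rewrite /single; case: eqP => [->//|/eqP np].
case: p np => [_|p np]; first by rewrite hpi.1.
rewrite -[LHS](_ : single a (pi a.+1) p.+1 = 0); last by rewrite /single (negPf np).
apply: (cochain_ext (single_cochain hf) hpi) => // x hx sx.
rewrite corestr_single ?sx // -(phi_proj hpi) ?sx //.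
by rewrite h ?sx.
Qed.

Lemma phi_comp_proj Q Q' pi pi' x :
  cochains gV Q pi -> cochains gV Q' pi' -> homog gW x ->
  tproj1 (phi gV Q pi (phi gV Q' pi' (tens (vecs x)))) =
  codersum Q' (corestr pi') x (corestr pi).
Proof.
move=> hpi hpi' hx; have [[Dl _ _] _] := phi_coder hpi.
rewrite (phi_coder hpi').2 // (codersum_map _ _ _ _ Dl).
rewrite (codersum_map _ _ _ _ (@tproj1P K V).1).
apply: codersum_eq => I J y J0 sI sJ sy _ _; apply: phi_proj => //.
  apply: (corletter_homog (corestr_deg hpi')) => //; exact: homog_sub hx _.
by rewrite size_cat addnS.
Qed.

Section Structure.
Variables (Q : zdeg n) (pi : nat -> seq V -> V).
Hypothesis hpi : cochains gV Q pi.

Lemma single_part s : (0 < s)%N -> cochains gV Q (single s.-1 (pi s)).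
Proof.
case: s => // s _; have := single_cochain (hpi.2 s.+1 isT).
by rewrite weight_arityK.
Qed.

Let part s := phi gV Q (single s.-1 (pi s)).

Lemma part_comp0 s t x : (0 < s)%N -> (0 < t)%N -> homog gW x ->
  (size x).+1 != (s + t)%N -> tproj1 (part s (part t (tens (vecs x)))) = 0.
Proof.
move=> s0 t0 hx nx; have hs := single_part s0; have ht := single_part t0.
rewrite phi_comp_proj //.
rewrite (@codersum_support _ _ _ gW _ _ t _ _ (fun=> 0 *: 0)) //.
- by rewrite -codersumZ scale0r.
- by move=> z; rewrite -{1}(prednK t0); apply: corestr_single.
- exact: corestr_multihomog hs.
- by move=> y z a k u v _ _ _ _; rewrite !scaler0 addr0.
move=> z sz; rewrite scaler0; apply: corestr_single; rewrite prednK //.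
by apply: contraNneq nx => <-; rewrite sz.
Qed.

(** D^2 is bilinear in the corestrictions: the sum splits according to the arity t
    of the inner one, and the length of the remaining word then fixes the arity of
    the outer one. *)
Lemma square_proj x : homog gW x ->
  tproj1 (phi gV Q pi (phi gV Q pi (tens (vecs x)))) =
  \sum_(1 <= s < (size x).+1) tproj1 (part s (part ((size x).+1 - s) (tens (vecs x)))).
Proof.
move=> hx; have qm := corestr_multihomog hpi.
(* the splitting is by the inner arity t, hence the reversal of the sum *)
rewrite phi_comp_proj // (codersum_split _ _ qm hx (leqnn _)) big_nat_rev /=.
rewrite !big_nat; apply: eq_bigr => s /andP [s0 sr].
rewrite add1n subSS; set t := ((size x).+1 - s)%N.
have t0 : (0 < t)%N by rewrite subn_gt0.
have hs := single_part s0; have ht := single_part t0.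
rewrite phi_comp_proj //.
have E r : (0 < r)%N -> restrict_arity (corestr pi) r = corestr (single r.-1 (pi r)).
  move=> r0; apply: funext => z; rewrite /restrict_arity; case: eqP => [zr|/eqP nz].
    by rewrite /corestr /single prednK // zr eqxx.
  by rewrite corestr_single // prednK.
rewrite E //; apply: (@codersum_support _ _ _ gW _ _ t) => //.
- by move=> z; rewrite -{1}(prednK t0); apply: corestr_single.
- exact: corestr_multihomog hs.
move=> z sz; rewrite -E // /restrict_arity.
have -> : size z = s by apply/eqP; rewrite -(eqn_add2r t) sz subnKC // ltnW.
by rewrite eqxx.
Qed.

Hypothesis oddQ : odd `|ip Q Q|%N.

Lemma gcomm_odd D D' (t : tensalg V) : gcomm Q Q D D' t = D (D' t) + D' (D t).
Proof. by rewrite /gcomm ksign_odd // scaleN1r opprK. Qed.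

(** Both pi_s and pi_t have weight Q after desuspension, so the stem bracket is
    computed from [D_s, D_t].  Its sign exponent is 1 + (s - 1) <e1, Q>, the same
    as that of the coefficient in the condition. *)
Lemma stem_part s t : (0 < s)%N -> (0 < t)%N ->
  let f := ksign K (1 + (s%:Z - 1) * ip e1 Q) *:
    stem gV (Q + (1 - s%:Z) *: e1) s.-1 (pi s) (Q + (1 - t%:Z) *: e1) t.-1 (pi t) in
  [/\ forall w, size w != (s + t).-1 -> f w = 0,
      forall w w', linear (fun v => f (w ++ v :: w')) &
      forall x, homog gW x -> size x = (s + t).-1 ->
        ksign K ((size x * (size x).-1)./2)%:Z *:
          (ksign K (upexp (degs x)) *: f (vecs x)) =
        tproj1 (part s (part t (tens (vecs x)))) +
        tproj1 (part t (part s (tens (vecs x))))].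
Proof.
case: s => // a _; case: t => // b _ f.
pose A := Q + (1 - a.+1%:Z) *: e1; pose B := Q + (1 - b.+1%:Z) *: e1.
pose G := gcomm Q Q (part a.+1) (part b.+1).
have fE : f = phi1_inv gV (A + B) (a + b) G.
  rewrite /f /stem /phi1 /= !weight_arityK [b%:Z *: e1 + _]addrC weight_arityK ipZl.
  have -> : a.+1%:Z - 1 = a%:Z :> int by rewrite intS addrAC subrr add0r.
  by rewrite scalerA ksign_sqr scale1r.
have wAB : A + B + (a + b)%:Z *: e1 = Q + Q.
  by rewrite PoszD scalerDl addrACA /A /B !weight_arityK.
have [ca _] := phi_coder (single_part (ltn0Sn a)).
have [cb _] := phi_coder (single_part (ltn0Sn b)).
have [pl _] := @tproj1P K V.
have GE x : tproj1 (G (tens (vecs x))) =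
    tproj1 (part a.+1 (part b.+1 (tens (vecs x)))) +
    tproj1 (part b.+1 (part a.+1 (tens (vecs x)))).
  by rewrite /G gcomm_odd (linD _ _ pl).
have [||hf fG] := @phi1_invP (A + B) (a + b) G.
- by rewrite wAB; apply: gcomm_coder.
- move=> x hx _ nx; rewrite GE !part_comp0 ?addr0 // addnS addSn eqSS //.
  by rewrite addnC.
rewrite -fE in hf fG; have [f0 fl _] := hf.
split=> // [w|x hx sx]; first by rewrite addnS addSn; apply: f0.
rewrite addnS addSn /= in sx.
rewrite -GE -fG /phi1 wAB -/(single _ _).
have := single_cochain hf; rewrite wAB => hs.
by rewrite phi_proj ?sx // /corestr /single sx eqxx.
Qed.

Hypothesis charK0 : [pchar K] =i pred0.

(** The p-th condition is the vanishing of the corestriction to p - 1 letters of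
    [D, D] = 2 D^2, which is a coderivation. *)
Lemma loday_codifferential :
  loday_condition gV Q pi <-> codifferential gW Q (phi gV Q pi).
Proof.
have [cD _] := phi_coder hpi; have [Dl _ _] := cD; have [pl _] := @tproj1P K V.
pose f p s := ksign K (1 + (s%:Z - 1) * ip e1 Q) *:
    stem gV (Q + (1 - s%:Z) *: e1) s.-1 (pi s)
            (Q + (1 - (p - s)%:Z) *: e1) (p - s).-1 (pi (p - s)%N).
have fsum p x : homog gW x -> (size x).+1 = p ->
    ksign K ((size x * (size x).-1)./2)%:Z *:
      (ksign K (upexp (degs x)) *: (\sum_(1 <= s < p) f p s) (vecs x)) =
    tproj1 (gcomm Q Q (phi gV Q pi) (phi gV Q pi) (tens (vecs x))).
  move=> hx <-; rewrite gcomm_odd (linD _ _ pl) !square_proj //.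
  rewrite fct_sumE !scaler_sumr.
  rewrite [X in _ = _ + X]big_nat_rev /= -big_split /= !big_nat.
  apply: eq_bigr => s /andP [s0 sx].
  have t0 : (0 < (size x).+1 - s)%N by rewrite subn_gt0.
  have [_ _ ->] := stem_part s0 t0 => //; last by rewrite subnKC // ltnW.
  by rewrite add1n subSS subKn // ltnW.
split=> [h|[_ DD] p p2].
  split=> // t.
  have G0 : gcomm Q Q (phi gV Q pi) (phi gV Q pi) = fun=> 0.
    apply: (coder_unique (gcomm_coder cD cD) (coder0 gW (Q + Q))) => x hx x0.
    rewrite (lin0 pl) -(fsum _ _ hx erefl) /f (h (size x).+1) //.
    by rewrite !scaler0.
  have := congr1 (fun F => F t) G0; rewrite gcomm_odd /= -mulr2n -scaler_nat => /eqP.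
  rewrite scaler_eq0 => /orP [|/eqP //].
  by have := charK0 2; rewrite !inE /= => ->.
have p0 : (0 < p)%N by apply: leq_trans p2.
have H s : (0 < s < p)%N -> [/\ forall w, size w != p.-1 -> f p s w = 0 &
    forall w w', linear (fun v => f p s (w ++ v :: w'))].
  move=> /andP [s0 sp]; have t0 : (0 < p - s)%N by rewrite subn_gt0.
  by have [h1 h2 _] := stem_part s0 t0; rewrite subnKC in h1; last exact: ltnW.
have p1 : p.-1 = p.-2.+1 by case: p p2 {p0 H} => [|[]].
apply: (@multilinear_ext p.-2) => //; rewrite -?p1.
- by move=> w nw; rewrite fct_sumE big_nat big1 // => s /H [h1 _]; apply: h1.
- move=> w w' k u v; rewrite !fct_sumE scaler_sumr -big_split /= !big_nat.
  by apply: eq_bigr => s /H [_ h2]; apply: h2.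
- by move=> w w' k u v; rewrite scaler0 addr0.
move=> x hx sx; have sp : (size x).+1 = p by rewrite sx prednK.
have := fsum _ _ hx sp; rewrite gcomm_odd !DD addr0 (lin0 pl).
by move=> /ksign_scale_eq0/ksign_scale_eq0.
Qed.

End Structure.
End Loday.

Theorem proposition7 (n : nat) (K : fieldType) (charK0 : [pchar K] =i pred0)
    (V : lmodType K) (gV : grading n V) (Q : zdeg n) (oddQ : odd `|ip Q Q|%N) :
  set_bij (cochains gV Q) (coderivation (desusp gV) Q) (phi gV Q) /\
  (forall pi, cochains gV Q pi ->
     (loday_condition gV Q pi <-> codifferential (desusp gV) Q (phi gV Q pi))).
Proof.
split; first exact: phi_bij.
by move=> pi hpi; apply: loday_codifferential.
Qed.
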